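(* Let $k\geqslant2$ and let $f$ be a nonnegative $k$-regular sequence. Suppose that $\rho({\bf B})$ is the unique dominant eigenvalue of ${\bf B}$, that $\rho:=\rho({\bf B})>\rho^*(\{{\bf B}_0,\dots,{\bf B}_{k-1}\})$, that $\Sigma(n)\neq0$ for all large $n$, and that the asymptotic behaviour of $\Sigma(n)$ is determined by $\rho$. If $$\prod_{j=0}^{k-1}\|{\bf B}_j\|^{1/k}<\frac{\rho}{k},$$ where $\|\cdot\|$ is the operator norm induced by the Euclidean norm, then the ghost measure of $f$ is purely singular continuous.
   Context: Let $k\geqslant2$. An integer sequence $f=(f(m))_{m\geqslant0}$ is $k$-regular if the $\mathbb Q$-vector space spanned by its $k$-kernel $\{(f(k^\ell n+r))_{n\geqslant0}:\ell\geqslant0,\ 0\leqslant r<k^\ell\}$ is finite-dimensional. Fix a basis $f=f_1,\dots,f_d$ of integer sequences, ${\bf f}(m)=(f_1(m),\dots,f_d(m))$ (row vector); the digit matrices ${\bf B}_0,\dots,{\bf B}_{k-1}\in\mathbb Z^{d\times d}$ satisfy ${\bf f}(km+a)={\bf f}(m){\bf B}_a$ for all $m\geqslant0$, $0\leqslant a<k$; ${\bf B}=\sum_a{\bf B}_a$. $\rho(\cdot)$ is spectral radius; $\rho^*(\{{\bf B}_0,\dots,{\bf B}_{k-1}\})=\limsup_n\max_{i_0,\dots,i_{n-1}}\|{\bf B}_{i_0}\cdots{\bf B}_{i_{n-1}}\|^{1/n}$. ''$\rho({\bf B})$ is the unique dominant eigenvalue'' means it is a simple eigenvalue and all other eigenvalues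 have strictly smaller modulus. $\Sigma(n)=\sum_{m=k^n}^{k^{n+1}-1}f(m)$; ''the asymptotic behaviour of $\Sigma(n)$ is determined by $\rho$'' means $\Sigma(n)=c\rho^n(1+o(1))$ for a constant $c\neq0$. $\mu_n=\frac1{\Sigma(n)}\sum_{m=0}^{k^{n+1}-k^n-1}f(k^n+m)\,\delta_{m/(k^n(k-1))}$ on $\mathbb T=[0,1)$; under the hypotheses these converge weakly to a continuous probability measure, the ghost measure of $f$. Purely singular continuous means: no atoms and singular with respect to Lebesgue measure. *)

(* Defs.v *)
From HB Require Import structures.
From mathcomp Require Import all_boot all_order all_algebra.
From mathcomp Require Import all_classical all_reals all_analysis.
From mathcomp Require Import complex.

Set Implicit Arguments.
Unset Strict Implicit.
Unset Printing Implicit Defensive.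

Import Order.TTheory GRing.Theory Num.Theory.
Import numFieldNormedType.Exports.
Local Open Scope classical_set_scope.
Local Open Scope ring_scope.

Definition kernel_seq (k : nat) (f : nat -> int) (l r : nat) : nat -> int :=
  fun n => f (k ^ l * n + r)%N.

Definition in_span_rows (d : nat) (F : nat -> 'rV[int]_d) (g : nat -> int) :=
  exists c : 'rV[rat]_d, forall n, (g n)%:~R = \sum_(i < d) c 0 i * ((F n) 0 i)%:~R.

(* The Q-vector space spanned by the k-kernel of f is finite-dimensional:
   there is a finite family of integer sequences whose Q-span contains
   every element of the k-kernel (equivalent to finite dimension of the span). *)
Definition k_regular (k : nat) (f : nat -> int) : Prop :=
  exists (d : nat) (G : nat -> 'rV[int]_d),
    forall l r, (r < k ^ l)%N -> in_span_rows G (kernel_seq k f l r).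

Definition in_kernel_span (k : nat) (f : nat -> int) (g : nat -> int) : Prop :=
  exists s : seq (nat * nat * rat),
    (forall t, t \in s -> (t.1.2 < k ^ t.1.1)%N) /\
    forall n, (g n)%:~R = \sum_(t <- s) t.2 * (kernel_seq k f t.1.1 t.1.2 n)%:~R.

Definition lin_indep_seqs (d : nat) (F : nat -> 'rV[int]_d) : Prop :=
  forall c : 'rV[rat]_d,
    (forall n, \sum_(i < d) c 0 i * ((F n) 0 i)%:~R = 0) -> c = 0.

Definition kernel_basis (k : nat) (f : nat -> int) (d : nat)
    (F : nat -> 'rV[int]_d.+1) : Prop :=
  [/\ forall m, (F m) 0 0 = f m,
      forall i, in_kernel_span k f (fun m => (F m) 0 i),
      forall l r, (r < k ^ l)%N -> in_span_rows F (kernel_seq k f l r)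
    & lin_indep_seqs F].

Definition mxR (R : realType) (m n : nat) (A : 'M[int]_(m, n)) : 'M[R]_(m, n) :=
  map_mx (fun z : int => z%:~R) A.

Definition cmod (R : realType) (z : R[i]) : R :=
  Num.sqrt (complex.Re z ^+ 2 + complex.Im z ^+ 2).

Definition char_polyC (R : realType) (n : nat) (A : 'M[R]_n) : {poly R[i]} :=
  char_poly (map_mx (real_complex R) A).

Definition eigenvalue_of (R : realType) (n : nat) (A : 'M[R]_n) (z : R[i]) : Prop :=
  root (char_polyC A) z.

Definition spectral_radius (R : realType) (n : nat) (A : 'M[R]_n) : R :=
  sup [set cmod z | z in eigenvalue_of A].

Definition unique_dominant_eigenvalue (R : realType) (n : nat) (A : 'M[R]_n)
    (r : R) : Prop :=
  [/\ eigenvalue_of A (real_complex R r),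
      ~~ ((('X - ((real_complex R r))%:P) ^+ 2) %| char_polyC A)
    & forall z, eigenvalue_of A z -> z != (real_complex R r) -> cmod z < r].

Definition euclid (R : realType) (n : nat) (v : 'rV[R]_n) : R :=
  Num.sqrt (\sum_(i < n) v 0 i ^+ 2).

(* operator norm induced by the Euclidean norm (acting on row vectors,
   v |-> v A; this equals the norm for the action on column vectors) *)
Definition opnorm (R : realType) (n : nat) (A : 'M[R]_n) : R :=
  sup [set euclid (v *m A) | v in [set v : 'rV[R]_n | euclid v <= 1]].

Definition max_prod_norm (R : realType) (k d : nat) (B : 'I_k -> 'M[R]_d) (n : nat) : R :=
  \big[Num.max/0]_(w : n.-tuple 'I_k) opnorm (\prod_(j < n) B (tnth w j)).

Definition joint_spectral_radius (R : realType) (k d : nat) (B : 'I_k -> 'M[R]_d)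
  : \bar R :=
  limn_esup (fun n => (max_prod_norm B n `^ (n%:R^-1))%:E).

Definition Sigma (k : nat) (f : nat -> int) (n : nat) : int :=
  \sum_(k ^ n <= m < k ^ n.+1) f m.

Definition mu_n_integral (R : realType) (k : nat) (f : nat -> int) (n : nat)
    (g : R -> R) : R :=
  ((Sigma k f n)%:~R)^-1 *
  \sum_(0 <= m < k ^ n.+1 - k ^ n) (f (k ^ n + m)%N)%:~R *
      g (m%:R / ((k ^ n)%:R * (k%:R - 1))).

(* continuous functions on the torus T = R/Z = [0,1), seen as continuous
   1-periodic functions on R *)
Definition torus_continuous (R : realType) (g : R -> R) : Prop :=
  continuous g /\ forall x, g (x + 1) = g x.

(* mu is a probability measure on T = [0,1) (a Borel probability on R
   concentrated on [0,1)) and is the weak limit of the mu_n *)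
Definition is_ghost_measure (R : realType) (k : nat) (f : nat -> int)
    (mu : probability R R) : Prop :=
  mu [set` `[0%R, 1%R[] = 1%E /\
  forall g : R -> R, torus_continuous g ->
    (fun n => (mu_n_integral k f n g)%:E) @ \oo -->
      (\int[mu]_(x in `[0%R, 1%R[) (g x)%:E)%E.

Definition purely_singular_continuous (R : realType) (mu : probability R R) : Prop :=
  (forall x : R, mu [set x] = 0%E) /\
  exists N : set R, [/\ measurable N, lebesgue_measure N = 0%E & mu N = 1%E].

(* Main.v *)
(** For [k ^ l <= N < k ^ l.+1], reading the base-[k] digits of [N] turns the
    [mu_n]-mass of the interval of points whose integer starts with the digits of
    [N] into [F N *m Bs ^+ (n - l)], up to normalisation. As [rho] is a simple
    dominant eigenvalue, Cayley-Hamilton makes [Bs ^+ n / rho ^+ n] converge, so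
    these masses converge to a finitely additive [p l N]; since [rho] exceeds the
    joint spectral radius they are uniformly small, and the cumulative function
    they define is continuous: its Stieltjes measure is the ghost measure.

    Singularity: [p l N <= C * \prod opnorm (B digit) / rho ^+ l]. For a
    Lebesgue-typical point every digit has frequency [1 / k], so its cell has mass
    far below [k ^- l]. Quantitatively (a Chernoff bound), the cells where this
    fails have exponentially small total length, whereas the other cells carry
    exponentially little mass; Borel-Cantelli gives the null set of full mass. *)

Require Import Defs.
From HB Require Import structures.
From mathcomp Require Import all_boot all_order all_algebra.
From mathcomp Require Import all_classical all_reals all_analysis.
From mathcomp Require Import complex.
From mathcomp Require Import zify ring lra.

Set Implicit Arguments.
Unset Strict Implicit.
Unset Printing Implicit Defensive.

Import Order.TTheory GRing.Theory Num.Theory.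
Import numFieldNormedType.Exports.
Local Open Scope classical_set_scope.
Local Open Scope ring_scope.

(** * Powers of a matrix with a simple dominant eigenvalue *)

(** Once [e n <= eps / 2 * (1 - a)], the affine map [x |-> a * x + eps / 2 * (1 - a)] dominates the
    recurrence; its fixed point is [eps / 2], and the distance to it decays like [a ^+ m]. *)
Lemma contracting_recurrence_cvg0 (R : realType) (a : R) (u e : nat -> R) :
  0 <= a < 1 -> (forall n, 0 <= u n) ->
  (forall n, u n.+1 <= a * u n + e n) ->
  e @ \oo --> (0 : R) -> u @ \oo --> (0 : R).
Proof.
move=> /andP[a0 a1] u0 ue e0; apply/cvgr0Pnorm_le => eps eps0.
have d0 : 0 < eps / 2 * (1 - a) by rewrite mulr_gt0 ?divr_gt0 ?subr_gt0.
have [N _ HN] : \forall n \near \oo, `|e n| <= eps / 2 * (1 - a).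
  by move/cvgr0Pnorm_le : e0; apply.
have bnd m : u (m + N)%N <= a ^+ m * u N + eps / 2.
  elim: m => [|m IH]; first by rewrite add0n expr0 mul1r lerDl divr_ge0// ltW.
  rewrite addSn (le_trans (ue _))//.
  have /= := HN (m + N)%N (leq_addl _ _); rewrite ler_norml => /andP[_ he].
  have := ler_wpM2l a0 IH; rewrite exprS; lra.
have : (fun m => u N * a ^+ m) @ \oo --> (0 : R).
  by apply: cvg_geometric; rewrite ger0_norm.
move=> /cvgr0Pnorm_le /(_ (eps / 2)) /(_ (divr_gt0 eps0 (ltr0n _ 2))) [M _ HM].
exists (M + N)%N => // n /= Mn.
have nN : (N <= n)%N by lia.
have {}Mn : (M <= n - N)%N by lia.
have := bnd (n - N)%N; rewrite subnK// ger0_norm// => h.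
have /= := HM _ Mn; rewrite ger0_norm ?mulr_ge0 ?exprn_ge0// mulrC; lra.
Qed.

Lemma cmod_normc (R : realType) (z : R[i]) : cmod z = ComplexField.Normc.normc z.
Proof. by case: z. Qed.

(** Induction on the roots, with [V] general. Entries x_n of [A ^+ n * V] satisfy x_{n+1} = z x_n +
    y_n, where y_n is the entry for [(A - z%:M) * V], a matrix killed by the remaining factors.
    Dividing by [rho ^+ n.+1] gives a contraction of ratio [cmod z / rho]; repeated roots do no
    harm. *)
Lemma expmx_mul_cvg0 (R : realType) (d : nat) (A : 'M[R[i]]_d.+1) (rho : R)
    (rs : seq R[i]) (V : 'M[R[i]]_d.+1) :
  0 < rho -> (forall z, z \in rs -> cmod z < rho) ->
  horner_mx A (\prod_(z <- rs) ('X - z%:P)) * V = 0 ->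
  forall i j, (fun n => cmod ((A ^+ n * V) i j) / rho ^+ n) @ \oo --> (0 : R).
Proof.
move=> rho0; elim: rs V => [|z rs IH] V.
  rewrite big_nil rmorph1 mul1r => _ -> i j.
  under eq_fun do rewrite mulr0 mxE cmod_normc ComplexField.Normc.normc0 mul0r.
  exact: cvg_cst.
rewrite big_cons mulrC rmorphM/= rmorphB/= horner_mx_X horner_mx_C -mulrA.
move=> zlt hV i j.
have {}IH : (fun n => cmod ((A ^+ n * ((A - z%:M) * V)) i j) / rho ^+ n) @ \oo
    --> (0 : R).
  by apply: IH => // y yrs; apply: zlt; rewrite inE yrs orbT.
have zrho : cmod z < rho by apply: zlt; rewrite mem_head.
have z0 : 0 <= cmod z by exact: sqrtr_ge0.
apply: (@contracting_recurrence_cvg0 _ (cmod z / rho) _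
  (fun n => cmod ((A ^+ n * ((A - z%:M) * V)) i j) / rho ^+ n * rho^-1)).
- by rewrite divr_ge0 ?(ltW rho0)//= ltr_pdivrMr// mul1r.
- by move=> n; rewrite divr_ge0 ?sqrtr_ge0 ?exprn_ge0// ltW.
- move=> n.
  have -> : (A ^+ n.+1 * V) i j =
      z * (A ^+ n * V) i j + (A ^+ n * ((A - z%:M) * V)) i j.
    have -> : A ^+ n * ((A - z%:M) * V) = A ^+ n.+1 * V - z *: (A ^+ n * V).
      by rewrite mulrBl mulrBr mulrA -exprSr -!mulmxE mul_scalar_mx -scalemxAr.
    by move: (A ^+ n.+1 * V) (A ^+ n * V) => X Y; rewrite !mxE; ring.
  set x := cmod ((A ^+ n * V) i j); set y := cmod ((A ^+ n * ((A - _) * V)) i j).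
  have -> : cmod z / rho * (x / rho ^+ n) + y / rho ^+ n / rho =
            (cmod z * x + y) / rho ^+ n.+1.
    by rewrite exprSr; field; rewrite ?expf_neq0 ?gt_eqF.
  rewrite ler_pM2r ?invr_gt0 ?exprn_gt0// /x /y !cmod_normc.
  rewrite -ComplexField.Normc.normcM.
  exact: le_normcD.
- by rewrite -(mul0r rho^-1); apply: cvgM IH (cvg_cst _).
Qed.

Lemma ler_norm_Re_cmod (R : realType) (z : R[i]) : `|complex.Re z| <= cmod z.
Proof. by rewrite -sqrtr_sqr ler_wsqrtr// lerDl sqr_ge0. Qed.

(** Write the characteristic polynomial as (X - r) q; simplicity gives q(r) != 0. Then P = q(A) /
    q(r) satisfies A P = r P by Cayley-Hamilton, and q(A) kills 1 - P, so A^n = r^n P + A^n (1 - P)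
    with a remainder o(rho^n). *)
Lemma expmx_dominant_cvg (R : realType) (d : nat) (A : 'M[R]_d.+1) (rho : R) :
  0 < rho -> unique_dominant_eigenvalue A rho ->
  exists H : 'M[R]_d.+1,
    forall i j, (fun n => (A ^+ n) i j / rho ^+ n) @ \oo --> H i j.
Proof.
move=> rho0 [rootrho simple dom].
set AC := map_mx (real_complex R) A.
set r := real_complex R rho in rootrho simple dom.
have [rs chiE] := closed_field_poly_normal (char_polyC A).
have chi_monic : char_polyC A \is monic by exact: char_poly_monic.
rewrite (eqP chi_monic) scale1r in chiE.
have rrs : r \in rs by move: rootrho; rewrite /eigenvalue_of chiE root_prod_XsubC.
rewrite (perm_big _ (perm_to_rem rrs)) big_cons /= in chiE.
set q := \prod_(z <- rem r rs) ('X - z%:P) in chiE.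
have rNrem : r \notin rem r rs.
  apply/negP => h; move/negP : simple; apply; rewrite chiE expr2.
  by rewrite dvdp_mul// dvdp_XsubCl root_prod_XsubC.
have qr0 : q.[r] != 0 by rewrite -rootE root_prod_XsubC.
have CH : horner_mx AC (('X - r%:P) * q) = 0.
  by rewrite -chiE; exact: Cayley_Hamilton.
pose P := q.[r]^-1 *: horner_mx AC q.
have ACP n : AC ^+ n * P = r ^+ n *: P.
  have AP : AC * P = r *: P.
    apply/eqP; rewrite -subr_eq0 -[r *: P]mul_scalar_mx mulmxE -mulrBl.
    move: CH; rewrite rmorphM rmorphB/= horner_mx_X horner_mx_C => CH.
    by rewrite -scalerAr CH scaler0.
  elim: n => [|n IH]; first by rewrite !expr0 mul1r scale1r.
  by rewrite exprSr -mulrA AP -scalerAr IH scalerA -exprS.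
(* The polynomial q(r) - q vanishes at r, so its product with q is a multiple of the characteristic
   polynomial. *)
have qV : horner_mx AC q * (1 - P) = 0.
  have : root (q.[r]%:P - q) r by rewrite rootE !hornerE subrr.
  move=> /factor_theorem[s qE].
  have -> : 1 - P = q.[r]^-1 *: horner_mx AC (q.[r]%:P - q).
    rewrite rmorphB/= horner_mx_C scalerBr.
    by rewrite -(scalemx1 _ q.[r]) scalerA mulVf// scale1r.
  by rewrite qE -scalerAr -rmorphM mulrCA [q * _]mulrC rmorphM/= CH mulr0 scaler0.
(* The powers of [A] are real, so the real part of P can serve as the limit. *)
exists (\matrix_(i, j) complex.Re (P i j)) => i j.
have remlt z : z \in rem r rs -> cmod z < rho.
  move=> zrem; apply: dom.
    by rewrite /eigenvalue_of chiE rootM root_prod_XsubC zrem orbT.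
  by apply: contraNneq rNrem => zr; rewrite -{1}zr.
have := expmx_mul_cvg0 rho0 remlt qV i j.
move=> /cvgr0Pnorm_le h; apply/cvgrPdist_le => e /h; apply: filter_app.
near=> n.
rewrite ger0_norm; last by rewrite divr_ge0 ?sqrtr_ge0 ?exprn_ge0// ltW.
apply: le_trans; rewrite distrC.
have -> : (A ^+ n) i j / rho ^+ n - (\matrix_(i, j) complex.Re (P i j)) i j =
    complex.Re ((AC ^+ n * (1 - P)) i j) / rho ^+ n.
  rewrite mulrBr mulr1 ACP -(rmorphXn (map_mx (real_complex R))) -(rmorphXn (real_complex R)).
  move: (P) => Q; rewrite !mxE; case: (Q i j) => a b /=.
  by rewrite mul0r subr0 mulrBl [_ * a]mulrC mulfK// gt_eqF// exprn_gt0.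
rewrite normrM normfV.
rewrite (ger0_norm (x := rho ^+ n)) ?exprn_ge0 ?(ltW rho0)//.
by rewrite ler_wpM2r ?invr_ge0 ?exprn_ge0 ?(ltW rho0)// ler_norm_Re_cmod.
Unshelve. all: by end_near. Qed.

(** * Measures with prescribed masses on k-adic cells *)

Lemma continuous_cdf_probability (R : realType) (G : R -> R) :
  {homo G : x y / x <= y} -> continuous G ->
  (forall x, x <= 0 -> G x = 0) -> (forall x, 1 <= x -> G x = 1) ->
  exists mu : probability R R, (forall x : R, mu [set x] = 0%E) /\
    forall a b : R, a <= b -> mu `[a, b[%classic = (G b - G a)%:E.
Proof.
move=> Gnd Gc G0 G1.
have GNy : G x @[x --> -oo] --> (0 : R).
  apply: cvg_near_cst; near=> x; apply: G0; near: x; exact: nbhs_ninfty_le.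
have Gy : G x @[x --> +oo] --> (1 : R).
  apply: cvg_near_cst; near=> x; apply: G1; near: x; exact: nbhs_pinfty_ge.
pose c : cumulativeBounded (0 : R) (1 : R) := HB.pack G
  (isCumulative.Build _ _ R G Gnd (right_continuousW Gc))
  (isCumulativeBounded.Build R 0 1 G GNy Gy).
pose P : probability (measurableTypeR R) R := lebesgue_stieltjes_measure c.
(* The Stieltjes measure lives on the alias [measurableTypeR R]; the same set function is repackaged
   as a probability on [R]. *)
pose m : set R -> \bar R := P.
pose m' : {measure set R -> \bar R} := HB.pack m
  (isMeasure.Build _ R R m (measure0 P) (measure_ge0 P)
     (@measure_semi_sigma_additive _ _ _ P)).
pose mu : probability R R := HB.pack m (Measure.class m')
  (Measure_isProbability.Build _ _ _ m' (probability_setT P)).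
have muoc (a b : R) : a <= b -> mu `]a, b]%classic = (G b - G a)%:E.
  move=> ab; change (lebesgue_stieltjes_measure c `]a, b]%classic = (G b - G a)%:E).
  rewrite /lebesgue_stieltjes_measure /measure_extension.
  rewrite measurable_mu_extE/=; last exact: is_ocitv.
  by rewrite wlength_itv_bnd.
move: (mu : probability R R) muoc => {c P m m' mu GNy Gy} mu muoc.
(* The point lies in []x - r / 2, x]], whose mass is an increment of [G], small by continuity. *)
have mu1 (x : R) : mu [set x] = 0%E.
  apply/eqP; rewrite eq_le measure_ge0 andbT; apply/lee_addgt0Pr => e e0.
  rewrite add0e.
  have /cvgrPdist_le /(_ e e0) /nbhs_ballP[r /= r0 xr] := Gc x.
  have hr : x - r / 2 <= x by rewrite lerBlDr lerDl divr_ge0// ltW.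
  have mx : (mu [set x] <= mu `](x - r / 2)%R, x]%classic)%E.
    rewrite le_measure ?inE//.
    move=> _ -> /=; rewrite in_itv/= lexx andbT.
    by rewrite ltrBlDr ltrDl divr_gt0.
  apply: (le_trans mx); rewrite muoc// lee_fin.
  apply: le_trans (ler_norm _) (xr _ _).
  by rewrite /ball/= opprB addrC subrK ger0_norm ?divr_ge0 ?(ltW r0)// gtr_pMr// invf_lt1// ltr1n.
exists mu; split => // a b; rewrite le_eqVlt => /orP[/eqP->|ab].
  by rewrite set_itvco0// measure0 subrr.
have hb : (mu `[a, b]%classic = mu `[a, b[%classic + mu [set b])%E.
  rewrite -measureU//; last first.
    apply/seteqP; split => // x [/=]; rewrite in_itv/= => /andP[_ xb] xE.
    by rewrite xE ltxx in xb.
  by rewrite setUitv1// bnd_simp ltW.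
have ha : (mu `[a, b]%classic = mu [set a] + mu `]a, b]%classic)%E.
  rewrite -measureU//; last first.
    apply/seteqP; split => // x [/=] ->; rewrite in_itv/= => /andP[].
    by rewrite ltxx.
  by rewrite setU1itv// bnd_simp ltW.
by move: hb; rewrite ha !mu1 adde0 add0e muoc ?(ltW ab)// => ->.
Unshelve. all: by end_near. Qed.


(** For N = k^l + m this is m / (k^l (k - 1)), the place where mu_l puts the mass f(N). The
    subtraction is done in [R], so it is not truncated. *)
Definition kadic_pt (R : realType) (k l N : nat) : R :=
  (N%:R - (k ^ l)%:R) / ((k ^ l)%:R * (k%:R - 1)).

Definition kadic_cell (R : realType) (k l N : nat) : set R :=
  `[kadic_pt R k l N, kadic_pt R k l N.+1[%classic.

Section kadic_mass.
Variables (R : realType) (k : nat) (p : nat -> nat -> R).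
Hypothesis k2 : (2 <= k)%N.
Hypothesis p_ge0 : forall l N, 0 <= p l N.
Hypothesis p_out : forall l N, ~~ (k ^ l <= N < k ^ l.+1)%N -> p l N = 0.
Hypothesis p_split : forall l N, p l N = \sum_(a < k) p l.+1 (k * N + a).
Hypothesis p_total : \sum_(0 <= u < k) p 0 u = 1.
Hypothesis p_small : forall e, 0 < e -> exists l, forall N, p l N <= e.

(** For M >= k^l, the mass to be given to the part of [0,1) left of [kadic_pt R k l M]; indices
    below k^l contribute nothing by [p_out]. *)
Let A l M := \sum_(0 <= N < M) p l N.

Let k0 : (0 < k)%N. Proof. exact: ltnW. Qed.
Let kl0 l : (0 < k ^ l)%N. Proof. by rewrite expn_gt0 k0. Qed.
Let k1R : 0 < k%:R - 1 :> R. Proof. by rewrite subr_gt0 ltr1n. Qed.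
Let klR l : 0 < (k ^ l)%:R :> R. Proof. by rewrite ltr0n. Qed.

Let A_ge0 l M : 0 <= A l M. Proof. exact: sumr_ge0. Qed.

Let A_nd l M M' : (M <= M')%N -> A l M <= A l M'.
Proof.
by move=> h; rewrite /A (big_cat_nat _ h)//= lerDl sumr_ge0.
Qed.

Let A_shift1 l M : A l.+1 (k * M) = A l M.
Proof.
rewrite /A mulnC big_nat_mul; apply: eq_bigr => N _.
by rewrite p_split mulSn addnC -{1}[(N * k)%N]add0n big_addn addKn big_mkord;
  apply: eq_bigr => a _; rewrite addnC mulnC.
Qed.

Let A_shift l j M : A (l + j) (k ^ j * M) = A l M.
Proof.
by elim: j => [|j IH]; rewrite ?addn0 ?mul1n// addnS expnS -mulnA A_shift1.
Qed.

Let A_top l : A l (k ^ l.+1) = 1.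
Proof. by have := A_shift 0 l k; rewrite add0n -expnSr => ->. Qed.

Let A_le1 l M : A l M <= 1.
Proof.
have [hM|/ltnW hM] := leqP M (k ^ l.+1).
  by rewrite (le_trans (A_nd l hM))// A_top.
rewrite /A (big_cat_nat (leq0n _) hM)//= -/(A _ _) A_top [X in _ + X]big_nat.
rewrite big1 ?addr0// => N /andP[h _]; rewrite p_out// negb_and -!leqNgt.
by rewrite h orbT.
Qed.

(** For x in [0,1), [T l x] is the index of the level-l cell containing x. [G] is the distribution
    function: the supremum over all levels of the mass of the whole cells to the left of x. *)
Let T l (x : R) := Num.truncn ((k ^ l)%:R * (1 + (k%:R - 1) * x)).
Let G (x : R) := sup (range (fun l => A l (T l x))).

Let G_has_sup x : has_sup (range (fun l => A l (T l x))).
Proof.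
split; first by exists (A 0 (T 0 x)), 0%N.
by exists 1 => _ [l _ <-]; exact: A_le1.
Qed.

(** Each term of the supremum is compared with [A l M] at the finer of the two levels, to which
    [A_shift] transports both. *)
Let G_le l M x : (k ^ l)%:R * (1 + (k%:R - 1) * x) <= M%:R -> G x <= A l M.
Proof.
move=> h; apply: ge_sup; first by case: (G_has_sup x).
move=> _ [l' _ <-]; have [ll'|/ltnW ll'] := leqP l l'.
  rewrite -(subnKC ll') -(A_shift l (l' - l) M) A_nd//.
  rewrite /T truncn_le_nat expnD natrM.
  apply: le_lt_trans (_ : (k ^ (l' - l) * M)%:R < _); last by rewrite ltr_nat.
  by rewrite natrM mulrAC mulrC ler_pM2l.
rewrite -(subnKC ll') -(A_shift l' (l - l') (T l' x)) A_nd//.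
(* For x far to the left the argument is negative and [Num.truncn] returns its default 0. *)
have [t0|t0] := leP 0 (1 + (k%:R - 1) * x); last first.
  have -> : T l' x = 0%N.
    apply/eqP; rewrite -leqn0 /T truncn_le_nat (lt_trans _ ltr01)//.
    by rewrite pmulr_rlt0.
  by rewrite muln0.
rewrite -(ler_nat R); apply: le_trans h.
rewrite natrM -{2}(subnK ll') expnD natrM -mulrA ler_pM2l//.
by rewrite /T truncn_le mulr_ge0.
Qed.

Let G_ge l M x : M%:R <= (k ^ l)%:R * (1 + (k%:R - 1) * x) -> A l M <= G x.
Proof.
move=> h; apply: (@le_trans _ _ (A l (T l x))).
  by rewrite A_nd// /T truncn_ge_nat// (le_trans _ h).
by apply: ub_le_sup; [case: (G_has_sup x)|exists l].
Qed.

Let G_ge0 x : 0 <= G x.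
Proof.
apply: (@le_trans _ _ (A 0 (T 0 x))) => //.
by apply: ub_le_sup; [case: (G_has_sup x)|exists 0%N].
Qed.

Let G_le1 x : G x <= 1.
Proof.
apply: ge_sup; first by case: (G_has_sup x).
by move=> _ [l _ <-]; exact: A_le1.
Qed.

Let G_nd : {homo G : x y / x <= y}.
Proof.
move=> x y xy; apply: ge_sup; first by case: (G_has_sup x).
move=> _ [l _ <-]; apply: (@le_trans _ _ (A l (T l y))).
  by apply/A_nd/le_truncn; rewrite ler_pM2l// lerD2l ler_pM2l.
by apply: ub_le_sup; [case: (G_has_sup y)|exists l].
Qed.

Let G_eq0 x : x <= 0 -> G x = 0.
Proof.
move=> x0; apply/eqP; rewrite eq_le G_ge0 andbT.
apply: le_trans (@G_le 0 1 x _) _.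
  by rewrite expn0 mul1r gerDl pmulr_rle0.
by rewrite /A big_nat1 p_out.
Qed.

Let G_eq1 x : 1 <= x -> G x = 1.
Proof.
move=> x1; apply/eqP; rewrite eq_le G_le1/= -p_total -/(A 0 k).
apply: G_ge; rewrite expn0 mul1r addrC -lerBlDr.
by rewrite ler_peMr// ltW.
Qed.

(** Moving x by less than one cell width [del] keeps [G] between [A l M.-1] and [A l M.+2]. At most
    three cells separate these bounds, each of mass at most e / 3; for M = 0 the predecessor is 0
    and there are two. *)
Let G_continuous : continuous G.
Proof.
move=> x; apply/cvgrPdist_le => e e0.
have [l pl] := p_small (divr_gt0 e0 (ltr0n R 3)).
pose del := ((k ^ l)%:R * (k%:R - 1))^-1 : R.
have del0 : 0 < del by rewrite invr_gt0 mulr_gt0.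
pose M := T l x.
have lo y : `|x - y| < del -> A l M.-1 <= G y.
  rewrite ltr_norml => /andP[h1 h2].
  have [M0|M0] := posnP M; first by rewrite M0 /A big_geq.
  apply: G_ge; have : M%:R <= (k ^ l)%:R * (1 + (k%:R - 1) * x).
    rewrite /M /T truncn_le mulr_ge0//.
    by rewrite leNgt; apply/negP => t0; move: M0;
      rewrite /M /T truncn_gt0 leNgt (lt_trans _ ltr01)// pmulr_rlt0.
  move: h2; rewrite /del -(ltr_pM2l (mulr_gt0 (klR l) k1R)) mulfV ?gt_eqF ?mulr_gt0//.
  rewrite -subn1 natrB//; lra.
have up y : `|x - y| < del -> G y <= A l M.+2.
  rewrite ltr_norml => /andP[h1 h2]; apply: G_le.
  have := truncnS_gt ((k ^ l)%:R * (1 + (k%:R - 1) * x)).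
  rewrite -/(T l x) -/M.
  move: h1; rewrite /del -(ltr_pM2l (mulr_gt0 (klR l) k1R)) mulrN mulfV ?gt_eqF ?mulr_gt0//.
  rewrite -[M.+2]addn1 -[M.+1]addn1 !natrD; lra.
have gap : A l M.+2 - A l M.-1 <= e.
  rewrite /A !big_nat_recr//=; case: (M) => [|m] /=.
    rewrite big_geq// subr0 add0r.
    have := pl 0%N; have := pl 1%N; lra.
  rewrite big_nat_recr//=; have := pl m; have := pl m.+1; have := pl m.+2; lra.
near=> y.
have xy : `|x - y| < del.
  by near: y; apply/nbhs_ballP; exists del.
have := lo x; have := lo y xy; have := up x; have := up y xy.
rewrite subrr normr0 => a1 /(_ del0) a2 a3 /(_ del0) a4.
rewrite ler_norml; apply/andP; split; lra.
Unshelve. all: by end_near. Qed.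

Let G_pt l N : (k ^ l <= N)%N -> G (kadic_pt R k l N) = A l N.
Proof.
move=> lN.
have E : (k ^ l)%:R * (1 + (k%:R - 1) * kadic_pt R k l N) = N%:R.
  by rewrite /kadic_pt; field; rewrite !gt_eqF.
by apply/eqP; rewrite eq_le G_le ?E//= G_ge ?E.
Qed.

Lemma kadic_probability : exists mu : probability R R,
  [/\ forall x : R, mu [set x] = 0%E, mu `[0%R, 1%R[%classic = 1%E &
    forall l N, (k ^ l <= N < k ^ l.+1)%N -> mu (kadic_cell k l N) = (p l N)%:E].
Proof.
have [mu [mu1 muE]] := continuous_cdf_probability G_nd G_continuous G_eq0 G_eq1.
exists mu; split => // [|l N /andP[lN _]].
  by rewrite muE// (G_eq0 (lexx _)) (G_eq1 (lexx _)) subr0.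
rewrite muE; last first.
  rewrite ler_pM2r ?invr_gt0 ?mulr_gt0// lerD2r ler_nat//.
rewrite !G_pt//; last exact: leqW.
by rewrite /A big_nat_recr//= [X in X - _]addrC addrK.
Qed.

End kadic_mass.

(** * Geometry of the k-adic cells *)

Section kadic_cells.
Variables (R : realType) (k : nat).
Hypothesis k2 : (2 <= k)%N.

Let kl0 l : 0 < (k ^ l)%:R :> R. Proof. by rewrite ltr0n expn_gt0 ltnW. Qed.
Let k1 : 0 < k%:R - 1 :> R. Proof. by rewrite subr_gt0 ltr1n. Qed.

(** In the rescaled coordinate the cells are the unit intervals [N, N + 1), so the cell index is an
    integer part; disjointness and covering follow. *)
Lemma kadic_cellP l N (x : R) : kadic_cell k l N x <->
  N%:R <= (k ^ l)%:R * (1 + (k%:R - 1) * x) < N.+1%:R.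
Proof.
rewrite /kadic_cell /= in_itv/= /kadic_pt.
rewrite ler_pdivrMr ?mulr_gt0// ltr_pdivlMr ?mulr_gt0//.
have -> : x * ((k ^ l)%:R * (k%:R - 1)) =
          (k ^ l)%:R * (1 + (k%:R - 1) * x) - (k ^ l)%:R by ring.
by rewrite lerD2r ltrD2r.
Qed.

Lemma measurable_kadic_cell l N : measurable (@kadic_cell R k l N).
Proof. exact: measurable_itv. Qed.

Lemma trivIset_kadic_cell l D : trivIset D (@kadic_cell R k l).
Proof.
move=> i j _ _ [x [/kadic_cellP/truncn_def <- /kadic_cellP/truncn_def]].
by move=> ->.
Qed.

Lemma kadic_cell_cover l :
  `[0%R, 1%R[%classic =
  \big[setU/set0]_(N <- index_iota (k ^ l) (k ^ l.+1)) @kadic_cell R k l N.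
Proof.
rewrite -bigcup_seq; apply/seteqP; split => [x|x [N /=]].
  rewrite /= in_itv/= => /andP[x0 x1].
  have t0 : 1 <= 1 + (k%:R - 1) * x by rewrite lerDl mulr_ge0// ltW.
  have s0 : (k ^ l)%:R <= (k ^ l)%:R * (1 + (k%:R - 1) * x) by rewrite ler_peMr// ltW.
  have s1 : 0 <= (k ^ l)%:R * (1 + (k%:R - 1) * x) by rewrite (le_trans _ s0)// ltW.
  exists (Num.truncn ((k ^ l)%:R * (1 + (k%:R - 1) * x))).
    rewrite /= mem_index_iota truncn_ge_nat// s0 truncn_lt_nat//.
    rewrite expnSr natrM ltr_pM2l// addrC -ltrBrDr.
    by rewrite -[X in _ < X]mulr1 ltr_pM2l.
  by apply/kadic_cellP; exact: truncn_itv.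
rewrite mem_index_iota => /andP[h1 h2] /kadic_cellP /andP[h3 h4].
rewrite in_itv/=; apply/andP; split.
  have : (k ^ l)%:R <= (k ^ l)%:R * (1 + (k%:R - 1) * x).
    by apply: le_trans h3; rewrite ler_nat.
  by rewrite -[X in X <= _]mulr1 ler_pM2l// lerDl pmulr_rge0.
have : (k ^ l)%:R * (1 + (k%:R - 1) * x) < (k ^ l)%:R * k%:R.
  by apply: lt_le_trans h4 _; rewrite -natrM -expnSr ler_nat.
by rewrite ltr_pM2l// addrC -ltrBrDr -[X in _ < X]mulr1 ltr_pM2l.
Qed.

Lemma kadic_pt_itv l N : (k ^ l <= N <= k ^ l.+1)%N ->
  0 <= kadic_pt R k l N <= 1.
Proof.
move=> /andP[h1 h2]; rewrite /kadic_pt divr_ge0 ?subr_ge0 ?ler_nat//; last first.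
  by rewrite mulr_ge0// ltW.
rewrite ler_pdivrMr ?mulr_gt0// mul1r mulrBr mulr1 lerD2r -natrM ler_nat.
by rewrite -expnSr.
Qed.

Lemma kadic_pt_refine l j N r : (r < k ^ j)%N ->
  `|kadic_pt R k l N - kadic_pt R k (l + j) (N * k ^ j + r)|
    < ((k ^ l)%:R * (k%:R - 1))^-1.
Proof.
move=> rj.
have -> : kadic_pt R k l N - kadic_pt R k (l + j) (N * k ^ j + r) =
    - (r%:R / (k ^ j)%:R * ((k ^ l)%:R * (k%:R - 1))^-1).
  rewrite /kadic_pt expnD natrD !natrM; field.
  by rewrite !gt_eqF.
rewrite normrN ger0_norm; last first.
  by rewrite mulr_ge0 ?divr_ge0 ?invr_ge0 ?mulr_ge0 ?(ltW k1).
by rewrite gtr_pMl ?invr_gt0 ?mulr_gt0// ltr_pdivrMr// mul1r ltr_nat.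
Qed.

Lemma lt_inv_kadic (d : R) : 0 < d -> exists l, ((k ^ l)%:R * (k%:R - 1))^-1 < d.
Proof.
move=> d0; exists (Num.truncn d^-1).+1.
rewrite invf_plt ?posrE ?mulr_gt0//.
apply: lt_le_trans (truncnS_gt _) _.
apply: (@le_trans _ _ (k ^ (Num.truncn d^-1).+1)%:R).
  by rewrite ler_nat ltnW// ltn_expl.
by rewrite ler_peMr ?(ltW (kl0 _))// lerBrDr -[1 + 1]/(2%:R) ler_nat.
Qed.

End kadic_cells.

Lemma big_nat_blocks (V : nmodType) (psi : nat -> V) (q a b : nat) : (a <= b)%N ->
  \sum_(a * q <= N < b * q) psi N =
  \sum_(a <= M < b) \sum_(0 <= r < q) psi (M * q + r)%N.
Proof.
move=> ab; rewrite -(subnKC ab); elim: (b - a)%N => [|m IH].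
  by rewrite addn0 !big_geq.
rewrite addnS big_nat_recr ?leq_addr//= -IH.
rewrite (big_cat_nat (leq_mul (leq_addr m a) (leqnn q)) (leq_mul (leqnSn (a + m)) (leqnn q)))/=.
congr (_ + _); rewrite mulSn; set c := ((a + m) * q)%N.
rewrite -{1}[c]add0n big_addn addnK.
by apply: eq_bigr => r _; rewrite addnC.
Qed.

(** Heine's theorem through near-coverings. Only [x] is confined to the segment; halving the local
    radius keeps both [x'] and [y] within reach of the centre. *)
Lemma continuous_uniform_segment (R : realType) (g : R -> R) (e : R) :
  continuous g -> 0 < e -> exists2 d, 0 < d &
    forall x y, 0 <= x <= 1 -> `|x - y| < d -> `|g x - g y| <= e.
Proof.
move=> gc e0.
have nc : near_covering (`[0 : R, 1]%classic : set R).
  exact/compact_near_coveringP/segment_compact.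
have [x _|d /= d0 hd] := nc R ((0 : R)^'+)
    (fun d x => forall y, `|x - y| < d -> `|g x - g y| <= e) _.
  have /cvgrPdist_le/(_ (e / 2)) := gc x.
  rewrite divr_gt0// => /(_ erefl) /nbhs_ballP[r /= r0 xr].
  exists (ball x (r / 2), [set d | d < r / 2]) => /=.
    split; first by apply/nbhs_ballP; exists (r / 2); rewrite /= ?divr_gt0.
    by apply: nbhs_right_lt; rewrite divr_gt0.
  move=> [x' d] /= [xx' dr] y x'y.
  have h1 := xr x' _; have h2 := xr y _.
  have {}h1 : `|g x - g x'| <= e / 2.
    by apply: h1; apply: lt_le_trans xx' _; lra.
  have {}h2 : `|g x - g y| <= e / 2.
    apply: h2; rewrite /ball/=.
    have -> : x - y = (x - x') + (x' - y) by ring.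
    move: xx'; rewrite /ball/= => xx'.
    by rewrite (le_lt_trans (ler_normD _ _))//; lra.
  have -> : g x' - g y = - (g x - g x') + (g x - g y) by ring.
  by rewrite (le_trans (ler_normD _ _))// normrN; lra.
exists (d / 2); first by rewrite divr_gt0.
move=> x y x01 xy; apply: (hd (d / 2)) => //=.
- by rewrite /ball/= sub0r normrN gtr0_norm ?divr_gt0//; lra.
- by rewrite divr_gt0.
Qed.

(** * Weak convergence *)

Section ghost_of_cells.
Variables (R : realType) (k : nat) (f : nat -> int) (p : nat -> nat -> R).
Variable mu : probability R R.
Hypothesis k2 : (2 <= k)%N.
Hypothesis f_ge0 : forall m, 0 <= f m.
Hypothesis Sigma_neq0 : \forall n \near \oo, Sigma k f n != 0.
Hypothesis mu_itv : mu `[0%R, 1%R[%classic = 1%E.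
Hypothesis mu_cell : forall l N, (k ^ l <= N < k ^ l.+1)%N ->
  mu (kadic_cell k l N) = (p l N)%:E.
Hypothesis ratio_cvg : forall l N, (k ^ l <= N < k ^ l.+1)%N ->
  (fun j => (\sum_(0 <= r < k ^ j) f (N * k ^ j + r)%N)%:~R / (Sigma k f (l + j))%:~R)
    @ \oo --> p l N.

Let fR m : R := (f m)%:~R.
Let fR_ge0 m : 0 <= fR m. Proof. by rewrite ler0z. Qed.

Let riemann l (g : R -> R) := \sum_(k ^ l <= N < k ^ l.+1) g (kadic_pt R k l N) * p l N.

Let mesh_lt l (d : R) N x : kadic_cell k l N x ->
  ((k ^ l)%:R * (k%:R - 1))^-1 < d -> `|kadic_pt R k l N - x| < d.
Proof.
rewrite /kadic_cell /= in_itv/= => /andP[h1 h2] hd.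
rewrite ler0_norm ?subr_le0// opprB.
have : kadic_pt R k l N.+1 - kadic_pt R k l N = ((k ^ l)%:R * (k%:R - 1))^-1.
  by rewrite /kadic_pt -natr1; ring.
lra.
Qed.

(** On each cell [g] differs by at most e from its value at the left end, and the masses of the
    cells sum to 1. *)
Lemma integral_near_riemann (g : R -> R) (d e : R) l :
  (forall x y, 0 <= x <= 1 -> `|x - y| < d -> `|g x - g y| <= e) ->
  ((k ^ l)%:R * (k%:R - 1))^-1 < d ->
  mu.-integrable `[0%R, 1%R[%classic (EFin \o g) ->
  `|fine (\int[mu]_(x in `[0%R, 1%R[%classic) (g x)%:E) - riemann l g| <= e.
Proof.
move=> unif hd gint.
have mcell N : measurable (kadic_cell k l N : set R) by exact: measurable_kadic_cell.
have sub N : (k ^ l <= N < k ^ l.+1)%N -> kadic_cell k l N `<=` (`[0%R, 1%R[%classic : set R).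
  move=> hN x cx; rewrite (kadic_cell_cover R k2 l) -bigcup_seq.
  by exists N; rewrite //= mem_index_iota.
have intE (h : R -> R) : mu.-integrable `[0%R, 1%R[%classic (EFin \o h) ->
    (\int[mu]_(x in `[0%R, 1%R[%classic) (h x)%:E =
    \sum_(k ^ l <= N < k ^ l.+1) \int[mu]_(x in kadic_cell k l N) (h x)%:E)%E.
  move=> /integrableP[mh _]; rewrite (kadic_cell_cover R k2 l) integral_bigsetU_EFin//.
  - exact: iota_uniq.
  - exact: trivIset_kadic_cell.
  - by rewrite -(kadic_cell_cover R k2 l).
have cellint N : (k ^ l <= N < k ^ l.+1)%N ->
    mu.-integrable (kadic_cell k l N) (EFin \o g).
  move=> hN; apply: integrableS gint => //; exact: sub.
have near N x : (k ^ l <= N < k ^ l.+1)%N -> kadic_cell k l N x ->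
    `|g (kadic_pt R k l N) - g x| <= e.
  move=> hN cx; apply: unif; last exact: mesh_lt cx hd.
  by apply: kadic_pt_itv => //; case/andP: hN => -> /ltnW ->.
have cell_cst N c : (k ^ l <= N < k ^ l.+1)%N ->
    (\int[mu]_(x in kadic_cell k l N) c%:E = (c * p l N)%:E)%E.
  move=> hN; rewrite (integral_cst _ (mcell N)).
  by rewrite EFinM; congr (_ * _)%E; exact: mu_cell.
have cstint (D : set R) c : measurable D -> mu.-integrable D (EFin \o cst c).
  move=> mD; apply: measurable_bounded_integrable => //.
    exact: le_lt_trans (probability_le1 _ mD) (ltry 1).
  by exists `|c|; split; [exact: num_real|move=> M /ltW cM x _].
(* Obtained by integrating the constant 1 over the cells. *)
have pe1 : \sum_(k ^ l <= N < k ^ l.+1) p l N = 1.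
  have mU : measurable (`[0%R, 1%R[%classic : set R) by exact: measurable_itv.
  have cellsE :
      (1%:E = \sum_(k ^ l <= N < k ^ l.+1) \int[mu]_(x in kadic_cell k l N) 1%:E)%E.
    transitivity (\int[mu]_(x in `[0%R, 1%R[) (cst 1 x)%:E)%E.
      apply: esym; apply: etrans (integral_cst mu mU 1%:E) _.
      by rewrite mul1e; exact: mu_itv.
    exact: intE (cstint _ 1 mU).
  apply: EFin_inj; rewrite -sumEFin; apply: etrans (esym cellsE).
  rewrite [LHS]big_nat_cond [RHS]big_nat_cond; apply: eq_bigr => N.
  by rewrite andbT => hN; rewrite cell_cst// mul1r.
have Ifin : (\int[mu]_(x in `[0%R, 1%R[%classic) (g x)%:E)%E \is a fin_num.
  exact: integrable_fin_num.
have lo : (\sum_(k ^ l <= N < k ^ l.+1) ((g (kadic_pt R k l N) - e) * p l N)%:E <=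
    \int[mu]_(x in `[0%R, 1%R[%classic) (g x)%:E)%E.
  rewrite intE//.
  rewrite big_nat_cond [leRHS]big_nat_cond; apply: lee_sum => N.
  rewrite andbT => hN; rewrite -cell_cst//.
  apply: le_integral; [exact: mcell|exact: cstint (mcell N)|exact: cellint|].
  move=> x /set_mem cx; rewrite lee_fin lerBlDl -lerBlDr.
  exact: le_trans (ler_norm _) (near _ _ hN cx).
have up : (\int[mu]_(x in `[0%R, 1%R[%classic) (g x)%:E <=
    \sum_(k ^ l <= N < k ^ l.+1) ((g (kadic_pt R k l N) + e) * p l N)%:E)%E.
  rewrite intE//.
  rewrite big_nat_cond [leRHS]big_nat_cond; apply: lee_sum => N.
  rewrite andbT => hN; rewrite -cell_cst//.
  apply: le_integral; [exact: mcell|exact: cellint|exact: cstint (mcell N)|].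
  move=> x /set_mem cx; rewrite lee_fin -lerBlDl.
  apply: le_trans (ler_norm _) _; rewrite distrC; exact: near.
move: lo up; rewrite -(fineK Ifin) !sumEFin !lee_fin; set I := fine _.
under eq_bigr do rewrite mulrBl; rewrite sumrB -mulr_sumr pe1 mulr1 => lo.
under eq_bigr do rewrite mulrDl; rewrite big_split/= -mulr_sumr pe1 mulr1 => up.
rewrite ler_norml /riemann; apply/andP; split; lra.
Qed.

Let ratio l N j : R :=
  (\sum_(0 <= r < k ^ j) f (N * k ^ j + r)%N)%:~R / (Sigma k f (l + j))%:~R.

Let level_blocks (V : nmodType) (psi : nat -> V) l j :
  \sum_(k ^ (l + j) <= m < k ^ (l + j).+1) psi m =
  \sum_(k ^ l <= N < k ^ l.+1) \sum_(0 <= r < k ^ j) psi (N * k ^ j + r)%N.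
Proof. by rewrite -addSn !expnD big_nat_blocks// leq_exp2l. Qed.

(** The atoms of mu_{l+j} are grouped by the level-l prefix N of their integer. [ratio l N j] is the
    mass of such a group, and all its atoms lie within one mesh of [kadic_pt R k l N]. *)
Lemma mu_n_near_riemann (g : R -> R) (d e : R) l j :
  (forall x y, 0 <= x <= 1 -> `|x - y| < d -> `|g x - g y| <= e) ->
  ((k ^ l)%:R * (k%:R - 1))^-1 < d -> Sigma k f (l + j) != 0 ->
  `|\sum_(k ^ l <= N < k ^ l.+1) g (kadic_pt R k l N) * ratio l N j -
    mu_n_integral k f (l + j) g| <= e.
Proof.
move=> unif hd S0.
have SR : (Sigma k f (l + j))%:~R = \sum_(k ^ l <= N < k ^ l.+1)
    \sum_(0 <= r < k ^ j) fR (N * k ^ j + r).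
  rewrite /Sigma level_blocks rmorph_sum; apply: eq_bigr => N _.
  by rewrite rmorph_sum.
have Spos : 0 < (Sigma k f (l + j))%:~R :> R.
  rewrite lt_neqAle eq_sym intr_eq0 S0 SR; apply: sumr_ge0 => N _.
  by apply: sumr_ge0 => r _.
have -> : mu_n_integral k f (l + j) g = (Sigma k f (l + j))%:~R^-1 *
    \sum_(k ^ l <= N < k ^ l.+1) \sum_(0 <= r < k ^ j)
      fR (N * k ^ j + r) * g (kadic_pt R k (l + j) (N * k ^ j + r)).
  rewrite /mu_n_integral; congr (_ * _).
  pose psi m := fR m * g (kadic_pt R k (l + j) m).
  rewrite -(level_blocks psi).
  have := @big_addn _ 0 +%R 0 (k ^ (l + j).+1) (k ^ (l + j)) xpredT psi.
  rewrite add0n => ->; apply: eq_bigr => m _.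
  by rewrite /psi /kadic_pt natrD addrK [(k ^ _ + m)%N]addnC.
have -> : \sum_(k ^ l <= N < k ^ l.+1) g (kadic_pt R k l N) * ratio l N j =
    (Sigma k f (l + j))%:~R^-1 * \sum_(k ^ l <= N < k ^ l.+1)
      \sum_(0 <= r < k ^ j) fR (N * k ^ j + r) * g (kadic_pt R k l N).
  rewrite mulr_sumr; apply: eq_bigr => N _.
  rewrite -mulr_suml /ratio rmorph_sum; ring.
rewrite -mulrBr normrM gtr0_norm ?invr_gt0// mulrC ler_pdivrMr// SR mulr_sumr.
rewrite -sumrB big_nat_cond [leRHS]big_nat_cond.
apply: le_trans (ler_norm_sum _ _ _) _; apply: ler_sum => N; rewrite andbT => hN.
rewrite -sumrB mulr_sumr big_nat_cond [leRHS]big_nat_cond.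
apply: le_trans (ler_norm_sum _ _ _) _; apply: ler_sum => r; rewrite andbT leq0n => hr.
rewrite -mulrBr normrM ger0_norm// mulrC ler_wpM2r//.
apply: unif; last exact: lt_trans (@kadic_pt_refine R k k2 l j N r hr) hd.
by apply: kadic_pt_itv => //; case/andP: hN => -> /ltnW ->.
Qed.

(** With l fixed by uniform continuity, three errors of e / 4 are added: integral against
    [riemann l g], the limit masses [p l N] against the ratios, and the ratios against mu_n. *)
Lemma is_ghost_measure_cells : is_ghost_measure k f mu.
Proof.
split=> // g [gc _].
have gint : mu.-integrable `[0%R, 1%R[%classic (EFin \o g).
  apply: measurable_bounded_integrable => //.
  - by apply: le_lt_trans (ltry 1); apply: probability_le1; exact: measurable_itv.
  - by apply: measurable_funTS; exact: measurable_realfun.continuous_measurable_fun.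
  - have /compact_bounded[M [Mreal gM]] : compact (g @` `[0, 1]%classic).
      apply: continuous_compact (@segment_compact _ _ _).
      exact: continuous_subspaceT.
    exists M; split => // r /gM bnd x /=; rewrite in_itv/= => /andP[x0 x1].
    by apply: bnd; exists x => //=; rewrite in_itv/= x0 ltW.
have Ifin : (\int[mu]_(x in `[0%R, 1%R[%classic) (g x)%:E)%E \is a fin_num.
  exact: integrable_fin_num.
rewrite -(fineK Ifin); apply: cvg_EFin; first by near=> n.
set I := fine _; apply/cvgrPdist_le => e e0.
have [d d0 unif] := continuous_uniform_segment gc (divr_gt0 e0 (ltr0n R 4)).
have [l hl] := lt_inv_kadic k2 d0.
have nearI := integral_near_riemann unif hl gint.
have nearQ : (fun j => \sum_(k ^ l <= N < k ^ l.+1) g (kadic_pt R k l N) * ratio l N j)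
    @ \oo --> riemann l g.
  rewrite /riemann; under eq_fun do rewrite big_nat_cond.
  rewrite big_nat_cond; apply: cvg_big => [|N /andP[hN _]].
    exact: add_continuous.
  by apply: cvgM; [exact: cvg_cst|exact: ratio_cvg].
move/cvgrPdist_le : nearQ => /(_ (e / 4)); rewrite divr_gt0// => /(_ erefl).
move=> [n1 _ hn1]; have [n2 _ hn2] := Sigma_neq0.
exists (l + n1 + n2)%N => // n /= hn; rewrite -(subnKC (_ : l <= n)%N); last by lia.
have Q1 : `|riemann l g - \sum_(k ^ l <= N < k ^ l.+1)
    g (kadic_pt R k l N) * ratio l N (n - l)| <= e / 4 by apply: hn1 => /=; lia.
have S0 : Sigma k f (l + (n - l)) != 0 by apply: hn2 => /=; lia.
have Q2 := mu_n_near_riemann unif hl S0.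
move: nearI Q1 Q2; rewrite -/I !ler_norml => /andP[? ?] /andP[? ?] /andP[? ?].
by apply/andP; split; lra.
Unshelve. all: by end_near. Qed.

End ghost_of_cells.
(** * Singularity *)

Lemma measure_bigsetU_le d (T : measurableType d) (R : realType)
    (mu : {measure set T -> \bar R}) (I : Type) (s : seq I) (P : pred I)
    (A : I -> set T) : (forall i, measurable (A i)) ->
  (mu (\big[setU/set0]_(i <- s | P i) A i) <= \sum_(i <- s | P i) mu (A i))%E.
Proof.
move=> mA; elim: s => [|i s IH]; first by rewrite !big_nil measure0.
rewrite !big_cons; case: ifP => // _; apply: le_trans (leeD2l _ IH).
by apply: measureU2 => //; exact: bigsetU_measurable.
Qed.

Lemma nneseries_geometric_lty (R : realType) (a r : R) : 0 <= a -> 0 <= r < 1 ->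
  (\sum_(n <oo) (a * r ^+ n)%:E < +oo)%E.
Proof.
move=> a0 /andP[r0 r1].
have c : series (geometric a r) @ \oo --> a * (1 - r)^-1.
  by apply: cvg_geometric_series; rewrite ger0_norm.
suff -> : (\sum_(n <oo) (a * r ^+ n)%:E)%E = (a * (1 - r)^-1)%:E by rewrite ltry.
apply/cvg_lim => //; rewrite (_ : (fun n => _) = EFin \o series (geometric a r)).
  by apply: cvg_EFin => //; apply: nearW.
by apply/funext => n; rewrite /= sumEFin.
Qed.

Section singular_of_heavy.
Variables (R : realType) (k : nat) (p : nat -> nat -> R) (mu : probability R R).
Hypothesis k2 : (2 <= k)%N.
Hypothesis mu_itv : mu `[0%R, 1%R[%classic = 1%E.
Hypothesis mu_cell : forall l N, (k ^ l <= N < k ^ l.+1)%N ->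
  mu (kadic_cell k l N) = (p l N)%:E.
Variables (heavy : nat -> pred nat) (c r : R).
Hypothesis c0 : 0 <= c.
Hypothesis r01 : 0 <= r < 1.
Hypothesis heavy_count : forall l,
  \sum_(k ^ l <= N < k ^ l.+1 | heavy l N) 1 <= c * r ^+ l * (k ^ l)%:R.
Hypothesis light_cvg0 :
  (fun l => \sum_(k ^ l <= N < k ^ l.+1 | ~~ heavy l N) p l N) @ \oo --> (0 : R).

Let H l : set R :=
  \big[setU/set0]_(N <- index_iota (k ^ l) (k ^ l.+1) | heavy l N) kadic_cell k l N.

Let mH l : measurable (H l).
Proof. by apply: bigsetU_measurable => N _; exact: measurable_kadic_cell. Qed.

Let lebesgue_cell l N :
  lebesgue_measure (kadic_cell k l N : set R) = (((k ^ l)%:R * (k%:R - 1))^-1)%:E.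
Proof.
have E : kadic_pt R k l N.+1 - kadic_pt R k l N = ((k ^ l)%:R * (k%:R - 1))^-1.
  by rewrite /kadic_pt -natr1; ring.
rewrite /kadic_cell lebesgue_measure_itv/= lte_fin -subr_gt0 E.
rewrite invr_gt0 mulr_gt0 ?ltr0n ?expn_gt0 ?(ltnW k2) ?subr_gt0 ?ltr1n//.
by rewrite -EFinB E.
Qed.

Let lebesgue_H l : (lebesgue_measure (H l) <= (c * r ^+ l)%:E)%E.
Proof.
apply: le_trans (measure_bigsetU_le _ _ _ _) _.
  by move=> N; exact: measurable_kadic_cell.
rewrite (eq_bigr (fun=> (1 * ((k ^ l)%:R * (k%:R - 1))^-1)%:E)); last first.
  by move=> N _; rewrite mul1r; exact: lebesgue_cell.
rewrite sumEFin lee_fin -mulr_suml.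
have k0 : 0 < (k ^ l)%:R :> R by rewrite ltr0n expn_gt0 ltnW.
have k1 : 1 <= k%:R - 1 :> R by rewrite lerBrDr -[1 + 1]/(2%:R) ler_nat.
have k1' : 0 < k%:R - 1 :> R by rewrite (lt_le_trans ltr01).
rewrite ler_pdivrMr ?mulr_gt0//; apply: le_trans (heavy_count l) _.
rewrite mulrA ler_peMr// mulr_ge0 ?(ltW k0)// mulr_ge0// exprn_ge0//.
by case/andP: r01.
Qed.

Let mu_H l : ((1 - \sum_(k ^ l <= N < k ^ l.+1 | ~~ heavy l N) p l N)%:E <= mu (H l))%E.
Proof.
rewrite EFinB leeBlDr//.
pose L := \big[setU/set0]_(N <- index_iota (k ^ l) (k ^ l.+1) | ~~ heavy l N)
  (kadic_cell k l N : set R).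
have mL : measurable L.
  by apply: bigsetU_measurable => N _; exact: measurable_kadic_cell.
have LE : (mu L <= (\sum_(k ^ l <= N < k ^ l.+1 | ~~ heavy l N) p l N)%:E)%E.
  apply: le_trans (measure_bigsetU_le _ _ _ _) _.
    by move=> N; exact: measurable_kadic_cell.
  rewrite -sumEFin big_nat_cond [leRHS]big_nat_cond.
  apply: lee_sum => N /andP[hN _]; rewrite le_eqVlt; apply/orP; left; apply/eqP.
  exact: mu_cell.
apply: le_trans (leeD2l _ LE); apply: le_trans (measureU2 _ (mH l) mL).
rewrite -mu_itv (kadic_cell_cover R k2 l) (bigID (heavy l))/=.
by rewrite /H /L.
Qed.

(** The set is the limsup of the heavy unions [H l]. Their Lebesgue measures are summable, so
    Borel-Cantelli makes it null. *)
Lemma singular_of_heavy : exists N : set R,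
  [/\ measurable N, lebesgue_measure N = 0%E & mu N = 1%E].
Proof.
exists (lim_sup_set H); split.
- apply: bigcap_measurable => // n _.
  by apply: bigcup_measurable => m _; exact: mH.
- apply: lim_sup_set_cvg0 => //.
  apply: le_lt_trans (nneseries_geometric_lty c0 r01).
  by apply: lee_nneseries => // n _; exact: lebesgue_H.
- have mU n : measurable (\bigcup_(j >= n) H j).
    by apply: bigcup_measurable => m _; exact: mH.
  apply/eqP; rewrite eq_le probability_le1/=; last first.
    exact: bigcap_measurable.
  apply/lee_addgt0Pr => e e0; rewrite -leeBlDr//.
  (* Continuity from above: each tail union contains [H n], whose mass is at least 1 minus the light
     mass, which tends to 0. *)
  have cv : mu (\bigcup_(j >= n) H j) @[n --> \oo] --> mu (lim_sup_set H).
    apply: lim_sup_set_cvg => //.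
    exact: le_lt_trans (probability_le1 _ (mU 0%N)) (ltry 1).
  apply: (cvge_to_ge cv).
  move/cvgr0Pnorm_le : light_cvg0 => /(_ e e0); apply: filter_app; near=> n.
  move=> hn; apply: (@le_trans _ _ (mu (H n))); last first.
    by rewrite le_measure ?inE// => x Hx; exists n => /=.
  apply: le_trans (mu_H n); rewrite -EFinB lee_fin lerD2l lerN2.
  exact: le_trans (ler_norm _) hn.
Unshelve. all: by end_near. Qed.

End singular_of_heavy.

(** * Roots of numbers with product below 1 *)

(** From exp(-x) >= 1 - x one gets exp(x) <= 1 / (1 - x), and (1 - x)(1 + x + 2x^2) = 1 + x^2 (1 -
    2x) >= 1. *)
Lemma expR_le_quadratic (R : realType) (x : R) : x <= 1 / 2 ->
  expR x <= 1 + x + 2 * x ^+ 2.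
Proof.
move=> x2; have x1 : 0 < 1 - x by lra.
have : expR x <= (1 - x)^-1.
  by rewrite -[expR x]invrK -expRN lef_pV2 ?posrE ?expR_gt0// expR_ge1Dx.
move=> /le_trans; apply; rewrite -[leLHS]mul1r ler_pdivrMr//.
have := sqr_ge0 x; nra.
Qed.

(** For t_j = y_j^(1/m) the sum is k + (1/m) sum_j ln y_j + O(1/m^2), and the first-order term is
    negative since the product is below 1. *)
Lemma sum_root_lt (R : realType) (k : nat) (y : 'I_k -> R) :
  (forall j, 0 < y j) -> \prod_j y j < 1 ->
  exists m : nat, exists t : 'I_k -> R,
    [/\ (0 < m)%N, forall j, 0 < t j, forall j, t j ^+ m = y j &
        \sum_j t j < k%:R].
Proof.
move=> y0 y1; pose L j := ln (y j).
have prod_gt0 : 0 < \prod_j y j by apply: prodr_gt0.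
have sumL : \sum_j L j < 0.
  have -> : \sum_j L j = ln (\prod_j y j).
    have : expR (\sum_j L j) = \prod_j y j.
      by rewrite expR_sum; apply: eq_bigr => j _; rewrite lnK ?posrE.
    by move=> <-; rewrite expRK.
  by rewrite ln_lt0// prod_gt0.
pose Q := \sum_j L j ^+ 2.
have Q0 : 0 <= Q by apply: sumr_ge0 => j _; exact: sqr_ge0.
(* The first summand forces L_j / m <= 1/2, as the quadratic bound demands; the second lets the
   linear term beat the quadratic one. *)
pose b := \sum_j 2 * `|L j| + 2 * Q / (- \sum_j L j).
pose m := (Num.truncn b).+1.
have bm : b < m%:R by exact: truncnS_gt.
have c0 : 0 <= 2 * Q / (- \sum_j L j) by rewrite divr_ge0 ?mulr_ge0// oppr_ge0 ltW.
have a0 : 0 <= \sum_j 2 * `|L j| by apply: sumr_ge0 => j _; rewrite mulr_ge0.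
have m0 : 0 < m%:R :> R by rewrite ltr0n.
have Lm j : L j / m%:R <= 1 / 2.
  rewrite ler_pdivrMr//.
  have : 2 * `|L j| <= \sum_j 2 * `|L j|.
    by rewrite (bigD1 j)//= lerDl sumr_ge0// => i _; rewrite mulr_ge0.
  have := ler_norm (L j); rewrite /b in bm; lra.
have Qm : 2 * Q < m%:R * (- \sum_j L j).
  by rewrite -ltr_pdivrMr ?oppr_gt0//; rewrite /b in bm; lra.
exists m, (fun j => expR (L j / m%:R)); split => // [j|j|]; first exact: expR_gt0.
  rewrite -expRM_natl mulrC divfK ?gt_eqF//.
  by rewrite /L lnK ?posrE.
have : \sum_j expR (L j / m%:R) <=
    \sum_j (1 + L j / m%:R + 2 * (L j / m%:R) ^+ 2).
  by apply: ler_sum => i _; exact: expR_le_quadratic.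
move=> /le_lt_trans; apply; rewrite !big_split/= -mulr_sumr.
under [X in _ + _ * X]eq_bigr do rewrite expr_div_n.
rewrite -!mulr_suml -/Q sumr_const card_ord -addrA gtrDl.
have -> : (\sum_j L j) / m%:R + 2 * (Q / m%:R ^+ 2) =
   (2 * Q - m%:R * - (\sum_j L j)) / m%:R ^+ 2 by field; rewrite gt_eqF.
by rewrite pmulr_llt0 ?subr_lt0// invr_gt0 exprn_gt0.
Qed.

(** * Multiplicative weights of base-k digits *)

Section digit_weight.
Variables (R : realType) (k : nat).
Hypothesis k0 : (0 < k)%N.

Definition digit_factor (b : 'I_k -> R) (a : nat) : R :=
  if insub a is Some i then b i else 0.

(** Only the last l digits count: an integer of level l has l + 1 digits, and its leading one gets
    no factor. *)
Fixpoint digit_weight (b : 'I_k -> R) (l N : nat) : R :=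
  if l is l'.+1 then digit_weight b l' (N %/ k) * digit_factor b (N %% k) else 1.

Lemma digit_factor_ord b (a : 'I_k) : digit_factor b a = b a.
Proof. by rewrite /digit_factor valK. Qed.

Lemma digit_weightS b l N (a : 'I_k) :
  digit_weight b l.+1 (k * N + a) = digit_weight b l N * b a.
Proof.
by rewrite /= mulnC divnMDl// divn_small// addn0 modnMDl modn_small// digit_factor_ord.
Qed.

Lemma digit_factor_ge0 b a : (forall j, 0 <= b j) -> 0 <= digit_factor b a.
Proof. by rewrite /digit_factor; case: insub. Qed.

Lemma digit_weight_ge0 b l N : (forall j, 0 <= b j) -> 0 <= digit_weight b l N.
Proof.
by move=> b0; elim: l N => //= l IH N; rewrite mulr_ge0// digit_factor_ge0.
Qed.

Lemma ler_digit_weight b b' l N : (forall j, 0 <= b j <= b' j) ->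
  digit_weight b l N <= digit_weight b' l N.
Proof.
move=> bb'; have b0 j : 0 <= b j by case/andP: (bb' j).
elim: l N => //= l IH N; rewrite ler_pM// ?digit_weight_ge0 ?digit_factor_ge0//.
by rewrite /digit_factor; case: insub => // j; case/andP: (bb' j).
Qed.

(** Positivity of m makes the default value 0 of [digit_factor] stable under the power. *)
Lemma digit_weightX b m l N : (0 < m)%N ->
  digit_weight b l N ^+ m = digit_weight (fun j => b j ^+ m) l N.
Proof.
move=> m0; elim: l N => /= [|l IH] N; first by rewrite expr1n.
rewrite exprMn IH; congr (_ * _); rewrite /digit_factor.
by case: insub => //; rewrite expr0n gtn_eqF.
Qed.

Lemma digit_weightZ c b l N :
  digit_weight (fun j => c * b j) l N = c ^+ l * digit_weight b l N.
Proof.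
elim: l N => /= [|l IH] N; first by rewrite mulr1.
rewrite IH exprS /digit_factor; case: insub => [j|]; last by rewrite !mulr0.
by ring.
Qed.

(** The last l digits vary independently, while k - 1 counts the choices of the leading digit. *)
Lemma sum_digit_weight b l :
  \sum_(k ^ l <= N < k ^ l.+1) digit_weight b l N =
  (k%:R - 1) * (\sum_j b j) ^+ l.
Proof.
elim: l => [|l IH].
  rewrite expr0 mulr1 big_const_nat iter_addr_0 expn0 expn1.
  by rewrite -[1]/(1%:R) -natrB.
rewrite expnSr [(k ^ l.+2)%N]expnSr big_nat_blocks ?leq_pexp2l//.
under eq_bigr => N _.
  rewrite big_mkord; under eq_bigr => a _ do rewrite mulnC digit_weightS.
  rewrite -mulr_sumr; over.
by rewrite -mulr_suml IH -mulrA -exprSr.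
Qed.

End digit_weight.
(** * Norms of matrix products *)

Lemma euclid_ge0 (R : realType) n (v : 'rV[R]_n) : 0 <= euclid v.
Proof. exact: sqrtr_ge0. Qed.

Lemma ler_norm_euclid (R : realType) n (v : 'rV[R]_n) i : `|v 0 i| <= euclid v.
Proof.
rewrite -sqrtr_sqr ler_wsqrtr// (bigD1 i)//= lerDl sumr_ge0// => j _.
exact: sqr_ge0.
Qed.

Lemma euclid_le_sum (R : realType) n (v : 'rV[R]_n) : euclid v <= \sum_i `|v 0 i|.
Proof.
have s0 : 0 <= \sum_i `|v 0 i| by exact: sumr_ge0.
rewrite -[leRHS]ger0_norm// -sqrtr_sqr ler_wsqrtr// expr2 mulr_suml.
apply: ler_sum => i _; rewrite -real_normK ?num_real// expr2.
by rewrite ler_wpM2l// (bigD1 i)//= lerDl sumr_ge0.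
Qed.

Lemma euclidZ (R : realType) n (a : R) (v : 'rV[R]_n) : euclid (a *: v) = `|a| * euclid v.
Proof.
rewrite /euclid -sqrtr_sqr -sqrtrM ?sqr_ge0// mulr_sumr; congr Num.sqrt.
by apply: eq_bigr => i _; rewrite mxE exprMn.
Qed.

(** Ensures that the [sup] defining [opnorm] is a genuine supremum. *)
Lemma has_ubound_opnorm (R : realType) n (A : 'M[R]_n) :
  has_ubound [set euclid (v *m A) | v in [set v : 'rV[R]_n | euclid v <= 1]].
Proof.
exists (\sum_j \sum_i `|A i j|) => _ [v /= v1 <-].
apply: le_trans (euclid_le_sum _) _; apply: ler_sum => j _; rewrite mxE.
apply: le_trans (ler_norm_sum _ _ _) _; apply: ler_sum => i _.
by rewrite normrM ler_piMl// (le_trans (ler_norm_euclid _ _)).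
Qed.

Lemma opnorm_ge0 (R : realType) n (A : 'M[R]_n) : 0 <= opnorm A.
Proof.
apply: (@le_trans _ _ (euclid (0 *m A))); first exact: euclid_ge0.
apply: ub_le_sup; first exact: has_ubound_opnorm.
by exists 0 => //=; rewrite -(scale0r 0) euclidZ normr0 mul0r.
Qed.

Lemma euclid_mulmx_le (R : realType) n (v : 'rV[R]_n) (A : 'M[R]_n) :
  euclid (v *m A) <= euclid v * opnorm A.
Proof.
have [v0|vn0] := eqVneq (euclid v) 0.
  have -> : v = 0.
    apply/rowP => i; rewrite mxE; apply/eqP; rewrite -normr_le0 -v0.
    exact: ler_norm_euclid.
  by rewrite mul0mx -(scale0r 0) euclidZ normr0 !mul0r.
have vpos : 0 < euclid v by rewrite lt_neqAle eq_sym vn0 euclid_ge0.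
rewrite mulrC -ler_pdivrMr// mulrC -[(euclid v)^-1]gtr0_norm ?invr_gt0//.
rewrite -euclidZ scalemxAl; apply: ub_le_sup; first exact: has_ubound_opnorm.
by exists ((euclid v)^-1 *: v) => //=; rewrite euclidZ gtr0_norm ?invr_gt0// mulVf.
Qed.

(** The limsup is an infimum of suprema over neighbourhoods of infinity, so one such supremum
    already lies below rho; raising to the n-th power gives the geometric bound. *)
Lemma joint_spectral_radius_lt (R : realType) (k d : nat) (B : 'I_k -> 'M[R]_d) (rho : R) :
  0 < rho -> (joint_spectral_radius B < rho%:E)%E ->
  exists r, 0 <= r < rho /\ \forall n \near \oo, max_prod_norm B n <= r ^+ n.
Proof.
move=> rho0 /ereal_inf_lt[_ [V Vn <-] supV].
have [r0 r0rho hV] : exists2 r0, r0 < rho &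
    forall n, V n -> max_prod_norm B n `^ (n%:R^-1) <= r0.
  move: supV; case E : (ereal_sup _) => [s| |]; rewrite ?lte_fin ?ltNge ?leey//.
    rewrite -ltNge => srho; exists s => // n Vn'; rewrite -lee_fin -E.
    by apply: ereal_sup_ubound; exists n.
  (* If the supremum is -oo, any number below rho serves as a bound. *)
  move=> _; exists (rho - 1) => [|n Vn']; first by rewrite gtrBl.
  rewrite -lee_fin; apply: le_trans (leNye _); rewrite -E.
  by apply: ereal_sup_ubound; exists n.
exists (Num.max r0 0); split; first by rewrite le_max lexx orbT gt_max r0rho.
apply: filterS2 Vn (nbhs_infty_gt 0) => n Vn' n0.
have m0 : 0 <= max_prod_norm B n by exact: bigmax_ge_id.
have -> : max_prod_norm B n = (max_prod_norm B n `^ (n%:R^-1)) ^+ n.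
  by rewrite -powR_mulrn ?powR_ge0// -powRrM mulVf ?powRr1// pnatr_eq0 -lt0n.
by rewrite lerXn2r ?nnegrE ?powR_ge0// ?le_max ?lexx ?orbT// hV.
Qed.

(** * Digit expansion of the linear representation *)

Section linear_representation.
Variables (R : realType) (k d : nat) (F : nat -> 'rV[R]_d.+1) (B : 'I_k -> 'M[R]_d.+1).
Hypothesis k2 : (2 <= k)%N.
Hypothesis FB : forall m (a : 'I_k), F (k * m + a)%N = F m *m B a.

Let k0 : (0 < k)%N. Proof. exact: ltnW. Qed.

(** Appending all strings of j digits to N and summing expands the j-th power of the sum of the
    digit matrices. *)
Lemma sum_block (N j : nat) :
  \sum_(0 <= r < k ^ j) F (N * k ^ j + r)%N = F N *m (\sum_a B a) ^+ j.
Proof.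
elim: j => [|j IH]; first by rewrite expn0 big_nat1 muln1 addn0 expr0 mulmx1.
have E := big_nat_blocks (fun r => F (N * k ^ j.+1 + r)%N) k (leq0n (k ^ j)).
rewrite mul0n -expnSr in E; rewrite E exprSr -mulmxE mulmxA -IH mulmx_suml.
apply: eq_bigr => M _; rewrite mulmx_sumr big_mkord; apply: eq_bigr => a _.
by rewrite -FB expnSr; congr F; ring.
Qed.

(** Integers are built from their nonzero leading digit by appending digits on the right. *)
Lemma level_ind (P : nat -> nat -> Prop) :
  (forall u, (1 <= u < k)%N -> P 0%N u) ->
  (forall l N (a : 'I_k), (k ^ l <= N < k ^ l.+1)%N -> P l N -> P l.+1 (k * N + a)%N) ->
  forall l N, (k ^ l <= N < k ^ l.+1)%N -> P l N.
Proof.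
move=> P0 PS; elim=> [|l IH] N; first by rewrite expn0 expn1; exact: P0.
move=> /andP[h1 h2]; have Nk : (N %% k < k)%N by rewrite ltn_mod.
have hN : (k ^ l <= N %/ k < k ^ l.+1)%N.
  by rewrite leq_divRL// -expnSr h1 ltn_divLR// -expnSr.
by have := PS l _ (Ordinal Nk) hN (IH _ hN); rewrite mulnC -divn_eq.
Qed.

Let U := \sum_(0 <= u < k) euclid (F u).

Let F_le_U u : (u < k)%N -> euclid (F u) <= U.
Proof.
move=> uk; rewrite /U (bigD1_seq u) ?iota_uniq ?mem_index_iota//= lerDl.
by apply: sumr_ge0 => v _; exact: euclid_ge0.
Qed.

(** Norm of the whole product of digit matrices: this bound is compared with the joint spectral
    radius and yields continuity. *)
Lemma euclid_le_max_prod : exists2 U, 0 <= U &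
  forall l N, (k ^ l <= N < k ^ l.+1)%N -> euclid (F N) <= U * max_prod_norm B l.
Proof.
exists U; first by apply: sumr_ge0 => u _; exact: euclid_ge0.
suff word l N : (k ^ l <= N < k ^ l.+1)%N -> exists u (w : l.-tuple 'I_k),
    (u < k)%N /\ F N = F u *m \prod_(j < l) B (tnth w j).
  move=> l N /word[u [w [uk ->]]]; apply: le_trans (euclid_mulmx_le _ _) _.
  rewrite ler_pM ?euclid_ge0 ?opnorm_ge0 ?F_le_U// /max_prod_norm.
  exact: (le_bigmax _ (fun w : l.-tuple 'I_k => opnorm (\prod_(j < l) B (tnth w j)))).
move: l N; apply: level_ind => [u /andP[_ uk]|l N a _ [u [w [uk FN]]]].
  by exists u, [tuple]; rewrite big_ord0 mulmx1.
exists u, [tuple of rcons w a]; split => //; rewrite FB FN -mulmxA.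
congr (_ *m _); rewrite big_ord_recr/= mulmxE; congr (_ * _).
  apply: eq_bigr => j _; congr B; rewrite !(tnth_nth a)/= nth_rcons size_tuple.
  by rewrite ltn_ord.
by congr B; rewrite (tnth_nth a)/= nth_rcons size_tuple ltnn eqxx.
Qed.

(** Product of the norms, digit by digit: cruder but multiplicative, as the singularity argument
    requires. *)
Lemma euclid_le_digit_weight : exists2 U, 0 <= U &
  forall l N, (k ^ l <= N < k ^ l.+1)%N ->
    euclid (F N) <= U * digit_weight (fun j => opnorm (B j)) l N.
Proof.
exists U; first by apply: sumr_ge0 => u _; exact: euclid_ge0.
apply: level_ind => [u /andP[_ uk]|l N a _ IH]; first by rewrite mulr1 F_le_U.
rewrite FB digit_weightS// mulrA; apply: le_trans (euclid_mulmx_le _ _) _.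
by rewrite ler_wpM2r ?opnorm_ge0.
Qed.

End linear_representation.

(** * Limiting masses of the cells *)

Section ghost_mass.
Variables (R : realType) (k d : nat) (f : nat -> int).
Variables (F : nat -> 'rV[R]_d.+1) (B : 'I_k -> 'M[R]_d.+1).
Variables (rho c : R) (h : 'cV[R]_d.+1).
Let A := \sum_a B a.
Hypothesis k2 : (2 <= k)%N.
Hypothesis F_f : forall m, F m 0 0 = (f m)%:~R.
Hypothesis FB : forall m (a : 'I_k), F (k * m + a)%N = F m *m B a.
Hypothesis f_ge0 : forall m, 0 <= f m.
Hypothesis rho_gt0 : 0 < rho.
Hypothesis c_neq0 : c != 0.
Hypothesis Sigma_neq0 : \forall n \near \oo, Sigma k f n != 0.
Hypothesis Sigma_sim : (fun n => (Sigma k f n)%:~R / (c * rho ^+ n)) @ \oo --> (1 : R).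
Hypothesis A_cvg : forall i, (fun n => (A ^+ n) i 0 / rho ^+ n) @ \oo --> h i 0.

Let k0 : (0 < k)%N. Proof. exact: ltnW. Qed.

(** Limit of the mu_n-mass of the integers beginning with the digits of N; [h] is the limit of the
    first column of A^n / rho^n, since f is the first coordinate of [F]. *)
Definition ghost_mass l N : R :=
  if (k ^ l <= N < k ^ l.+1)%N then (F N *m h) 0 0 / (c * rho ^+ l) else 0.

Let row_cvg (v : 'rV[R]_d.+1) :
  (fun n => (v *m A ^+ n) 0 0 / rho ^+ n) @ \oo --> (v *m h) 0 0.
Proof.
rewrite mxE; under eq_fun do rewrite mxE mulr_suml.
apply: cvg_big => [|i _]; first exact: add_continuous.
under eq_fun do rewrite -mulrA.
by apply: cvgM; [exact: cvg_cst|exact: A_cvg].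
Qed.

(** Shifting n by one in the limit that defines [h] shows that A h = rho h, tested here against a
    row [v]. *)
Let eigen (v : 'rV[R]_d.+1) : (v *m A *m h) 0 0 = rho * (v *m h) 0 0.
Proof.
rewrite -(cvg_lim (@Rhausdorff R) (@row_cvg (v *m A))).
apply: (cvg_lim (@Rhausdorff R)).
have -> : (fun n => (v *m A *m A ^+ n) 0 0 / rho ^+ n) =
    (fun n => rho * ((v *m A ^+ n.+1) 0 0 / rho ^+ n.+1)).
  apply/funext => n; rewrite -mulmxA mulmxE -exprS [rho ^+ n.+1]exprS.
  by field; rewrite !gt_eqF ?exprn_gt0.
apply: cvgM; first exact: cvg_cst.
by rewrite (cvg_shiftS (fun n => (v *m A ^+ n) 0 0 / rho ^+ n)).
Qed.

Lemma ghost_mass_ratio l N : (k ^ l <= N < k ^ l.+1)%N ->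
  (fun j => (\sum_(0 <= r < k ^ j) f (N * k ^ j + r)%N)%:~R / (Sigma k f (l + j))%:~R)
    @ \oo --> ghost_mass l N.
Proof.
move=> hN; rewrite /ghost_mass hN.
have S1 : (fun j => ((Sigma k f (l + j))%:~R / (c * rho ^+ (l + j)))^-1) @ \oo --> (1 : R).
  rewrite -[1 in X in _ --> X]invr1; apply: cvgV; first exact: oner_neq0.
  under eq_fun do rewrite addnC.
  by move: Sigma_sim; rewrite -(cvg_shiftn l).
rewrite (_ : (fun j => _) = fun j => (F N *m A ^+ j) 0 0 / rho ^+ j / (c * rho ^+ l) *
    ((Sigma k f (l + j))%:~R / (c * rho ^+ (l + j)))^-1).
  rewrite -[X in _ --> X]mulr1; apply: cvgM S1; apply: cvgM; last exact: cvg_cst.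
  exact: row_cvg.
apply/funext => j; rewrite -(sum_block FB) summxE rmorph_sum/=.
under eq_bigr do rewrite -F_f.
rewrite invf_div exprD; move: (_%:~R^-1) => z.
by field; rewrite c_neq0 !gt_eqF ?exprn_gt0.
Qed.

(** The sign of [c] is not given, so nonnegativity is inherited from the ratios, whose terms involve
    f >= 0 only. *)
Lemma ghost_mass_ge0 l N : 0 <= ghost_mass l N.
Proof.
have [hN|/negbTE hN] := boolP (k ^ l <= N < k ^ l.+1)%N; last by rewrite /ghost_mass hN.
apply: (cvgr_to_ge (ghost_mass_ratio hN)); apply: nearW => j.
by rewrite divr_ge0// ler0z; apply: sumr_ge0.
Qed.

Lemma ghost_mass_out l N : ~~ (k ^ l <= N < k ^ l.+1)%N -> ghost_mass l N = 0.
Proof. by rewrite /ghost_mass => /negbTE ->. Qed.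

(** Summing over the appended digit replaces F(N) h by F(N) A h = rho F(N) h, and the extra rho is
    absorbed by the normalisation of level l + 1. *)
Lemma ghost_mass_split l N :
  ghost_mass l N = \sum_(a < k) ghost_mass l.+1 (k * N + a).
Proof.
have level (a : 'I_k) : (k ^ l.+1 <= k * N + a < k ^ l.+2)%N = (k ^ l <= N < k ^ l.+1)%N.
  have aE : ((k * N + a) %/ k)%N = N by rewrite mulnC divnMDl// divn_small// addn0.
  by rewrite !expnSr -leq_divRL// -ltn_divLR// aE.
rewrite /ghost_mass; under [RHS]eq_bigr do rewrite level FB.
case: ifP => _; last by rewrite big1.
rewrite -mulr_suml -summxE -mulmx_suml -mulmx_sumr eigen exprS.
by field; rewrite c_neq0 !gt_eqF ?exprn_gt0.
Qed.

(** The blocks of the leading digits 1, ..., k - 1 partition the range of [Sigma k f j], so the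
    ratios sum to exactly 1 for large j. *)
Lemma ghost_mass_total : \sum_(0 <= u < k) ghost_mass 0 u = 1.
Proof.
rewrite (@big_cat_nat _ _ _ 1)//= big_nat1 [ghost_mass 0 0]ghost_mass_out// add0r.
have c1 : (fun j => \sum_(1 <= u < k)
    ((\sum_(0 <= r < k ^ j) f (u * k ^ j + r)%N)%:~R / (Sigma k f j)%:~R : R))
    @ \oo --> (1 : R).
  apply: cvg_near_cst; move: Sigma_neq0; apply: filter_app; near=> n => Sn.
  rewrite -mulr_suml -rmorph_sum -big_nat_blocks// mul1n -expnS.
  by rewrite divff// intr_eq0.
rewrite -(cvg_lim (@Rhausdorff R) c1); apply/esym/(cvg_lim (@Rhausdorff R)).
rewrite big_nat_cond; under eq_fun do rewrite big_nat_cond.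
apply: cvg_big => [|u /andP[hu _]]; first exact: add_continuous.
by have := @ghost_mass_ratio 0 u; rewrite expn0 expn1; apply.
Unshelve. all: by end_near. Qed.

Lemma ghost_mass_le : exists2 C, 0 <= C &
  forall l N, (k ^ l <= N < k ^ l.+1)%N -> ghost_mass l N <= C * euclid (F N) / rho ^+ l.
Proof.
exists ((\sum_i `|h i 0|) / `|c|); first by rewrite divr_ge0// sumr_ge0.
move=> l N hN; rewrite /ghost_mass hN; apply: le_trans (ler_norm _) _.
rewrite normrM normfV normrM [`|rho ^+ l|]gtr0_norm ?exprn_gt0// invfM mulrA.
rewrite ler_pM2r ?invr_gt0 ?exprn_gt0// [leRHS]mulrAC ler_pM2r ?invr_gt0 ?normr_gt0//.
rewrite mxE mulr_suml; apply: le_trans (ler_norm_sum _ _ _) _.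
apply: ler_sum => i _; rewrite normrM mulrC ler_wpM2l//.
exact: ler_norm_euclid.
Qed.

Lemma ghost_mass_small : (joint_spectral_radius B < rho%:E)%E ->
  forall e, 0 < e -> exists l, forall N, ghost_mass l N <= e.
Proof.
move=> /(joint_spectral_radius_lt rho_gt0)[r [/andP[r0 rrho] maxr]] e e0.
have [C C0 hC] := ghost_mass_le.
have [U U0 hU] := euclid_le_max_prod k2 FB.
have : (fun l => C * U * (r / rho) ^+ l) @ \oo --> (0 : R).
  by apply: cvg_geometric; rewrite ger0_norm ?divr_ge0 ?(ltW rho_gt0)// ltr_pdivrMr// mul1r.
move=> /cvgr0Pnorm_le /(_ e e0) small.
have [l [h1 h2]] := filter_ex (filterI maxr small).
exists l => N; have [hN|hN] := boolP (k ^ l <= N < k ^ l.+1)%N; last first.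
  by rewrite ghost_mass_out// ltW.
apply: le_trans (hC _ _ hN) _; apply: le_trans (le_trans (ler_norm _) h2).
rewrite expr_div_n mulrA ler_pM2r ?invr_gt0 ?exprn_gt0// -mulrA ler_wpM2l//.
by apply: le_trans (hU _ _ hN) _; rewrite ler_wpM2l.
Qed.

End ghost_mass.

(** * Chernoff bound for the digit weights *)

(** [sum_root_lt] is applied to (b_j + e) / q: some b_j may vanish, whereas logarithms demand
    positive numbers. *)
Lemma dominating_root_weights (R : realType) (k : nat) (b : 'I_k -> R) (q : R) :
  (0 < k)%N -> (forall j, 0 <= b j) -> 0 < q ->
  \prod_j (b j `^ (k%:R^-1)) < q ->
  exists m : nat, exists t : 'I_k -> R,
    [/\ (0 < m)%N, forall j, 0 < t j, forall j, b j <= q * t j ^+ m &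
        \sum_j t j < k%:R].
Proof.
move=> k0 b0 q0 bq.
have prod_lt : \prod_j b j < q ^+ k.
  have -> : \prod_j b j = (\prod_j (b j `^ (k%:R^-1))) ^+ k.
    rewrite -prodrXl; apply: eq_bigr => j _.
    by rewrite -powR_mulrn ?powR_ge0// -powRrM mulVf ?powRr1// pnatr_eq0 -lt0n.
  by rewrite ltrXn2r ?prodr_ge0 ?(ltW q0)// -?lt0n// => j _; rewrite powR_ge0.
(* Continuity in e keeps the product below q^k for some e > 0. *)
have cv : (fun e => \prod_j (b j + e)) @ (0 : R)^'+ --> \prod_j b j.
  apply: cvg_big => [|j _]; first exact: mul_continuous.
  rewrite -[X in _ --> X]addr0; apply: cvgD; first exact: cvg_cst.
  exact: cvg_at_right_filter.
have [e [e0 he]] : exists e, 0 < e /\ \prod_j (b j + e) < q ^+ k.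
  apply: filter_ex (filterI (nbhs_right_gt 0) _).
  by apply: (cvgr_lt _ cv).
have y0 j : 0 < (b j + e) / q by rewrite divr_gt0// ltr_wpDl.
have y1 : \prod_j ((b j + e) / q) < 1.
  by rewrite prodf_div prodr_const card_ord ltr_pdivrMr ?exprn_gt0// mul1r.
have [m [t [m0 t0 tm st]]] := sum_root_lt y0 y1.
exists m, t; split => // j.
by rewrite tm mulrC divfK ?gt_eqF// lerDl ltW.
Qed.

Section singular_of_digit_weight.
Variables (R : realType) (k : nat) (p : nat -> nat -> R) (mu : probability R R).
Hypothesis k2 : (2 <= k)%N.
Hypothesis p_ge0 : forall l N, 0 <= p l N.
Hypothesis mu_itv : mu `[0%R, 1%R[%classic = 1%E.
Hypothesis mu_cell : forall l N, (k ^ l <= N < k ^ l.+1)%N ->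
  mu (kadic_cell k l N) = (p l N)%:E.
Variables (b : 'I_k -> R) (rho C : R).
Hypothesis b_ge0 : forall j, 0 <= b j.
Hypothesis rho_gt0 : 0 < rho.
Hypothesis C_ge0 : 0 <= C.
Hypothesis p_le : forall l N, (k ^ l <= N < k ^ l.+1)%N ->
  p l N <= C * digit_weight b l N / rho ^+ l.
Hypothesis prod_lt : \prod_j (b j `^ (k%:R^-1)) < rho / k%:R.

(* Chernoff bound: if t j ^+ m dominates b j * k / rho and the mean of the t j is
   below tau < 1, then the cells of weight above tau ^+ l are exponentially rare
   for Lebesgue measure, while the others carry a vanishing part of mu. *)
Lemma singular_of_digit_weight : exists N : set R,
  [/\ measurable N, lebesgue_measure N = 0%E & mu N = 1%E].
Proof.
have k0 : (0 < k)%N := ltnW k2.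
have kR : 0 < k%:R :> R by rewrite ltr0n.
have [m [t [m0 t0 bt st]]] :=
  dominating_root_weights k0 b_ge0 (divr_gt0 rho_gt0 kR) prod_lt.
have tge0 j : 0 <= t j by exact: ltW.
set T := \sum_j t j in st.
have T0 : 0 <= T by exact: sumr_ge0.
(* The midpoint of T / k and 1: above the mean of the t_j, so heavy cells are rare, and below 1, so
   light cells are small. *)
pose tau := (1 + T / k%:R) / 2.
have Tk : T / k%:R < 1 by rewrite ltr_pdivrMr// mul1r.
have Tk0 : 0 <= T / k%:R by rewrite divr_ge0// ltW.
have tau0 : 0 < tau by rewrite /tau; lra.
have tau1 : tau < 1 by rewrite /tau; lra.
have Ttau : T / k%:R < tau by rewrite /tau; lra.
clearbody tau.
pose heavy l : pred nat := fun N => tau ^+ l < digit_weight t l N.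
apply: (@singular_of_heavy R k p mu k2 mu_itv mu_cell heavy
  (k%:R - 1) (T / k%:R / tau)).
- by rewrite subr_ge0 ler1n.
- by rewrite divr_ge0 ?(ltW tau0)//= ltr_pdivrMr// mul1r.
- move=> l.
  have -> : (k%:R - 1) * (T / k%:R / tau) ^+ l * (k ^ l)%:R =
      (k%:R - 1) * T ^+ l / tau ^+ l.
    by rewrite !expr_div_n natrX; field; rewrite !gt_eqF ?exprn_gt0.
  (* Markov's inequality: each heavy cell contributes more than tau^l to the total weight (k - 1)
     T^l. *)
  rewrite ler_pdivlMr ?exprn_gt0// -(sum_digit_weight k0) mulr_suml.
  rewrite [leRHS](bigID (heavy l))/= -[leLHS]addr0 lerD//.
    by apply: ler_sum => N; rewrite /heavy mul1r => /ltW.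
  by apply: sumr_ge0 => N _; exact: digit_weight_ge0.
- have lim0 : (fun l => C * k%:R * (tau ^+ m) ^+ l) @ \oo --> (0 : R).
    apply: cvg_geometric; rewrite ger0_norm ?exprn_ge0 ?(ltW tau0)//.
    by rewrite exprn_ilt1 ?(ltW tau0)// -lt0n.
  apply: (squeeze_cvgr _ (cvg_cst 0) lim0); apply: nearW => l.
  apply/andP; split; first by apply: sumr_ge0.
  (* On a light cell the weight of b is at most (rho / k)^l tau^(m l). There are at most k^(l+1)
     such cells, whence a total of at most C k tau^(m l). *)
  have cellle N : (k ^ l <= N < k ^ l.+1)%N -> ~~ heavy l N ->
      p l N <= C * (tau ^+ m) ^+ l / (k ^ l)%:R.
    move=> hN; rewrite /heavy -leNgt => light.
    apply: le_trans (p_le hN) _.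
    have Wb : digit_weight b l N <= (rho / k%:R) ^+ l * digit_weight t l N ^+ m.
      rewrite digit_weightX// -digit_weightZ; apply: ler_digit_weight => j.
      by rewrite b_ge0 bt.
    have Wt : digit_weight t l N ^+ m <= (tau ^+ m) ^+ l.
      by rewrite exprAC lerXn2r ?nnegrE ?digit_weight_ge0 ?exprn_ge0 ?(ltW tau0).
    rewrite -!mulrA ler_wpM2l// ler_pdivrMr ?exprn_gt0//.
    apply: le_trans (le_trans Wb (ler_wpM2l _ Wt)) _.
      by rewrite exprn_ge0// divr_ge0// ltW.
    rewrite expr_div_n natrX le_eqVlt; apply/orP; left; apply/eqP.
    by field; rewrite expf_neq0 ?gt_eqF.
  set c := C * (tau ^+ m) ^+ l / (k ^ l)%:R in cellle.
  have c0 : 0 <= c by rewrite divr_ge0// mulr_ge0// !exprn_ge0// ltW.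
  apply: (@le_trans _ _ (\sum_(k ^ l <= N < k ^ l.+1 | ~~ heavy l N) c)).
    rewrite big_nat_cond [leRHS]big_nat_cond; apply: ler_sum => N /andP[hN light].
    exact: cellle.
  apply: (@le_trans _ _ (\sum_(k ^ l <= N < k ^ l.+1) c)).
    by rewrite [leRHS](bigID (heavy l))/= lerDr sumr_ge0.
  rewrite big_const_nat iter_addr_0 -[c *+ _]mulr_natr.
  apply: (@le_trans _ _ (c * (k ^ l.+1)%:R)); first by rewrite ler_wpM2l// ler_nat leq_subr.
  rewrite /c expnS natrM le_eqVlt; apply/orP; left; apply/eqP.
  by field; rewrite pnatr_eq0 -lt0n expn_gt0 k0.
Qed.

End singular_of_digit_weight.

(** * Existence and singularity of the ghost measure *)

Theorem theorem8 (R : realType) (k d : nat) (f : nat -> int)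
    (F : nat -> 'rV[int]_d.+1) (B : 'I_k -> 'M[int]_d.+1) :
  (2 <= k)%N ->
  k_regular k f ->
  kernel_basis k f F ->
  (forall (m : nat) (a : 'I_k), F (k * m + a)%N = F m *m B a) ->
  (forall m, 0 <= f m) ->
  let Bs : 'M[R]_d.+1 := \sum_(a < k) mxR R (B a) in
  let rho := spectral_radius Bs in
  unique_dominant_eigenvalue Bs rho ->
  (joint_spectral_radius (fun a => mxR R (B a)) < rho%:E)%E ->
  (\forall n \near \oo, Sigma k f n != 0) ->
  (exists c : R, c != 0 /\
     (fun n => (Sigma k f n)%:~R / (c * rho ^+ n)) @ \oo --> (1 : R)) ->
  \prod_(j < k) (opnorm (mxR R (B j)) `^ (k%:R^-1)) < rho / k%:R ->
  exists mu : probability R R,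
    is_ghost_measure k f mu /\ purely_singular_continuous mu.
Proof.
move=> k2 _ [Ff _ _ _] FB f0 Bs rho dom jsr S0 [c [c0 Ssim]] prod_lt.
have kR : 0 < k%:R :> R by rewrite ltr0n ltnW.
(* Positivity comes from the norm hypothesis, whose left-hand side is nonnegative. *)
have rho0 : 0 < rho.
  have : 0 < rho / k%:R.
    by apply: le_lt_trans prod_lt; apply: prodr_ge0 => j _; exact: powR_ge0.
  by rewrite pmulr_lgt0 ?invr_gt0.
have [H Hcvg] := expmx_dominant_cvg rho0 dom.
pose FR m := mxR R (F m).
pose BR a := mxR R (B a).
have FBR m (a : 'I_k) : FR (k * m + a)%N = FR m *m BR a by rewrite /FR FB /mxR map_mxM.
have FRf m : FR m 0 0 = (f m)%:~R by rewrite mxE Ff.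
have colcvg i : (fun n => (Bs ^+ n) i 0 / rho ^+ n) @ \oo --> (col 0 H) i 0.
  by rewrite mxE; exact: Hcvg.
pose p := ghost_mass k FR rho c (col 0 H).
have p_ge0 : forall l N, 0 <= p l N.
  exact: ghost_mass_ge0 FRf FBR f0 rho0 c0 Ssim colcvg.
have [mu [mu1 mu_itv mu_cell]] := kadic_probability k2 p_ge0
  (@ghost_mass_out R k d FR rho c (col 0 H))
  (ghost_mass_split k2 FBR rho0 c0 colcvg)
  (ghost_mass_total k2 FRf FBR rho0 c0 S0 Ssim colcvg)
  (ghost_mass_small (col 0 H) k2 FBR rho0 c0 jsr).
exists mu; split.
  apply: (is_ghost_measure_cells k2 f0 S0 mu_itv mu_cell) => l N hN.
  exact: (ghost_mass_ratio FRf FBR rho0 c0 Ssim colcvg hN).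
split => //.
have [C C0 hC] := ghost_mass_le k FR (col 0 H) rho0 c0.
have [U U0 hU] := euclid_le_digit_weight k2 FBR.
apply: (singular_of_digit_weight k2 p_ge0 mu_itv mu_cell (b := fun j => opnorm (BR j))
  (C := C * U) _ rho0) => //.
- by move=> j; exact: opnorm_ge0.
- exact: mulr_ge0.
- move=> l N hN; apply: le_trans (hC _ _ hN) _.
  by rewrite ler_pM2r ?invr_gt0 ?exprn_gt0// -mulrA ler_wpM2l// hU.
Qed.
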